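(* The problem VB-AM Probabilistic Lobbying (defined in the context), parameterized by the budget $B$, is in W[2].
   Context: Probabilistic lobbying setting. There are $m$ voters $v_1,\dots,v_m$ and $n$ issues $r_1,\dots,r_n$. A probability matrix $P=(p_{i,j})\in(\mathbb{Q}\cap[0,1])^{m\times n}$ gives the probability that $v_i$ votes ''yes'' on $r_j$. A discretization level $k\in\mathbb{N}$ is chosen so that $k+1$ is a common multiple of the denominators of all $p_{i,j}$; admissible probability values are $0,\frac1{k+1},\dots,1$. For each $(i,j)$ a price function $c_{i,j}:\{0,\frac1{k+1},\dots,1\}\to\mathbb{N}$ with $c_{i,j}(p_{i,j})=0$, monotone in the sense that $p_{i,j}\le a\le b$ or $p_{i,j}\ge a\ge b$ implies $c_{i,j}(a)\le c_{i,j}(b)$, gives the price of changing $v_i$'s probability on $r_j$ to $a$; these form a cost matrix $C_P$ with $mn$ rows and $k+2$ columns. The Lobby has a target vector $\vec Z\in\{0,1\}^n$ and integer budget $B$; a threshold $t\in\mathbb{Q}\cap[0,1]$ is given. Average majority (AM): $r_j$ is won iff the average over voters of the probability of voting $Z_j$ ($p_{i,j}$ if $Z_j=1$, $1-p_{i,j}$ if $Z_j=0$) exceeds $t$. Voter bribery (VB): The Lobby chooses an amount $d_i\ge0$ per voter, $\sum_i d_i\le B$; $d_i$ is split equally among the $n$ issues, and for each $j$ the probability of $v_i$ on $r_j$ moves toward $Z_j$ to the farthest admissible value $a$ with $c_{i,j}(a)\le d_i/n$. VB-AM Probabilistic Lobbying: given $P,C_P,\vec Z,B$ (and $t$), decide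 whether some voter bribery within budget $B$ makes every issue won under AM. W[2] is the second level of the W-hierarchy of parameterized complexity. *)

(* Defs.v *)
From mathcomp Require Import all_boot all_order all_algebra.

Set Implicit Arguments.
Unset Strict Implicit.
Unset Printing Implicit Defensive.

Import Order.TTheory GRing.Theory Num.Theory.

(* Running times are those of a random access machine with addition,        *)
(* cut-off subtraction, halving and indirect addressing under the uniform   *)
(* cost measure; without multiplication this model is polynomially          *)
(* equivalent to Turing machines.  Programs are structured (while programs  *)
(* instead of jumps).  Directly addressed registers and indirectly          *)
(* addressed memory cells are kept apart, so that the input does not occupy *)
(* the registers a program works with.                                      *)

Inductive cmd : Type :=
| CConst (x v : nat)          (* R[x] := v *)
| CAdd (x y z : nat)          (* R[x] := R[y] + R[z] *)
| CSub (x y z : nat)          (* R[x] := R[y] - R[z], cut off at 0 *)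
| CHalf (x y : nat)           (* R[x] := R[y] / 2, rounded down *)
| CLoad (x y : nat)           (* R[x] := M[R[y]] *)
| CStore (x y : nat)          (* M[R[x]] := R[y] *)
| CSeq (c1 c2 : cmd)
| CIf (x : nat) (c1 c2 : cmd) (* if R[x] <> 0 then c1 else c2 *)
| CWhile (x : nat) (c : cmd). (* while R[x] <> 0 do c *)

Record state : Type := State { reg : nat -> nat; mem : nat -> nat }.

Definition upd (f : nat -> nat) (x v : nat) : nat -> nat :=
  fun y => if y == x then v else f y.

Definition set_reg (s : state) (x v : nat) : state :=
  State (upd (reg s) x v) (mem s).

Definition set_mem (s : state) (a v : nat) : state :=
  State (reg s) (upd (mem s) a v).

(* [exec c s t s']: from state [s], [c] halts in state [s'] after [t] steps. *)
Inductive exec : cmd -> state -> nat -> state -> Prop :=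
| exec_const x v s :
    exec (CConst x v) s 1 (set_reg s x v)
| exec_add x y z s :
    exec (CAdd x y z) s 1 (set_reg s x (reg s y + reg s z))
| exec_sub x y z s :
    exec (CSub x y z) s 1 (set_reg s x (reg s y - reg s z))
| exec_half x y s :
    exec (CHalf x y) s 1 (set_reg s x (reg s y)./2)
| exec_load x y s :
    exec (CLoad x y) s 1 (set_reg s x (mem s (reg s y)))
| exec_store x y s :
    exec (CStore x y) s 1 (set_mem s (reg s x) (reg s y))
| exec_seq c1 c2 s1 s2 s3 t1 t2 :
    exec c1 s1 t1 s2 -> exec c2 s2 t2 s3 ->
    exec (CSeq c1 c2) s1 (t1 + t2) s3
| exec_if_true x c1 c2 s s' t :
    reg s x != 0 -> exec c1 s t s' -> exec (CIf x c1 c2) s t.+1 s'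
| exec_if_false x c1 c2 s s' t :
    reg s x = 0 -> exec c2 s t s' -> exec (CIf x c1 c2) s t.+1 s'
| exec_while_stop x c s :
    reg s x = 0 -> exec (CWhile x c) s 1 s
| exec_while_step x c s1 s2 s3 t1 t2 :
    reg s1 x != 0 -> exec c s1 t1 s2 -> exec (CWhile x c) s2 t2 s3 ->
    exec (CWhile x c) s1 (t1 + t2).+1 s3.

(* Inputs and outputs are finite sequences of natural numbers.  A sequence  *)
(* is presented with its length in R[0] and its entries in M[0], M[1], ...; *)
(* registers and cells not mentioned are initially 0.                       *)
Definition word : Type := seq nat.

(* Length of a word when its entries are written in binary. *)
Definition bitlen (x : nat) : nat := (trunc_log 2 x).+1.
Definition wsize (w : word) : nat := \sum_(x <- w) bitlen x.

Definition init_state (w : word) : state :=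
  State (fun r => if r == 0 then size w else 0) (nth 0 w).

(* The bound on [size w'] charges for the length of the output, which could *)
(* otherwise be exponential in the running time by announcing in R[0] a     *)
(* large number of untouched cells.                                         *)
Definition computes_within (p : cmd) (w : word) (T : nat) (w' : word) : Prop :=
  exists (t : nat) (s : state),
    [/\ exec p (init_state w) t s,
        t <= T /\ size w' <= T,
        reg s 0 = size w'
      & forall i, i < size w' -> mem s i = nth 0 w' i].

Definition computable (f : nat -> nat) : Prop :=
  exists p : cmd, forall x, exists T, computes_within p [:: x] T [:: f x].

Record pproblem : Type := PProblem {
  instance_of : Type;
  encode : instance_of -> word;
  param : instance_of -> nat;
  yes : instance_of -> Prop }.

(* Many-one reductions computable in time f(k) * |x|^O(1), with f computable, *)
(* such that the new parameter is bounded by a computable function of the old *)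
(* one.                                                                       *)
Definition fpt_reducible (A B : pproblem) : Prop :=
  exists (r : instance_of A -> instance_of B) (p : cmd)
         (f g : nat -> nat) (c : nat),
    [/\ computable f, computable g
      & forall x : instance_of A,
        [/\ yes x <-> yes (r x),
            param (r x) <= g (param x)
          & computes_within p (encode x)
              (f (param x) * (wsize (encode x)).+1 ^ c) (encode (r x))]].

(* The nodes of a circuit with [ninputs] inputs are numbered: first the     *)
(* inputs 0, ..., ninputs - 1, then the gates in the order of the list.     *)
(* Gates refer to earlier nodes; the output is the last node.               *)
Inductive gate : Type :=
| GNot (a : nat)
| GAnd (s : seq nat)
| GOr (s : seq nat).

Definition gate_args (g : gate) : seq nat :=
  match g with GNot a => [:: a] | GAnd s => s | GOr s => s end.

Definition large (g : gate) : bool := 2 < size (gate_args g).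

Record circuit : Type := Circuit { ninputs : nat; gates : seq gate }.

Definition circuit_wf (C : circuit) : bool :=
  (0 < ninputs C + size (gates C)) &&
  [forall i : 'I_(size (gates C)),
     all (fun a => a < ninputs C + i)
         (gate_args (nth (GAnd [::]) (gates C) i))].

Definition gate_value (vs : seq bool) (g : gate) : bool :=
  match g with
  | GNot a => ~~ nth false vs a
  | GAnd s => all (nth false vs) s
  | GOr s => has (nth false vs) s
  end.

Definition circuit_value (C : circuit) (a : (ninputs C).-tuple bool) : bool :=
  last false (foldl (fun vs g => rcons vs (gate_value vs g)) a (gates C)).

(* Maximal number of gates, resp. of large gates, on a path from an input   *)
(* to the output.                                                           *)
Definition depth (C : circuit) : nat :=
  last 0 (foldl (fun ds g => rcons ds (\max_(a <- gate_args g) nth 0 ds a).+1)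
                (nseq (ninputs C) 0) (gates C)).

Definition weft (C : circuit) : nat :=
  last 0 (foldl (fun ws g =>
                   rcons ws (large g + \max_(a <- gate_args g) nth 0 ws a))
                (nseq (ninputs C) 0) (gates C)).

Definition encode_gate (g : gate) : word :=
  match g with
  | GNot a => [:: 0; 1; a]
  | GAnd s => [:: 1, size s & s]
  | GOr s => [:: 2, size s & s]
  end.

Record wcs_instance (t h : nat) : Type := WcsInstance {
  wcs_circuit : circuit;
  wcs_weight : nat;
  wcs_wf : circuit_wf wcs_circuit;
  wcs_weft : weft wcs_circuit <= t;
  wcs_depth : depth wcs_circuit <= h }.

Definition wcs_encode t h (I : wcs_instance t h) : word :=
  [:: ninputs (wcs_circuit I); wcs_weight I; size (gates (wcs_circuit I))]
  ++ flatten [seq encode_gate g | g <- gates (wcs_circuit I)].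

Definition wcs_yes t h (I : wcs_instance t h) : Prop :=
  exists a : (ninputs (wcs_circuit I)).-tuple bool,
    count id a = wcs_weight I /\ circuit_value a.

(* Weighted satisfiability of circuits of weft at most t and depth at most h. *)
Definition WCS (t h : nat) : pproblem :=
  @PProblem (wcs_instance t h) (@wcs_encode t h) (@wcs_weight t h)
            (@wcs_yes t h).

Definition W (t : nat) (A : pproblem) : Prop :=
  exists h : nat, fpt_reducible A (WCS t h).

Local Open Scope ring_scope.

Definition admissible (k : nat) (s : 'I_k.+2) : rat := s%:R / k.+1%:R.

(* The price function of voter i on issue j is given by its values          *)
(* [cost i j s] at the admissible probabilities s / (k + 1).                *)
Record vbam_instance : Type := VbamInstance {
  nvoters : nat;
  nissues : nat;
  level : nat;
  prob : 'M[rat]_(nvoters, nissues);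
  cost : 'I_nvoters -> 'I_nissues -> 'I_level.+2 -> nat;
  target : 'I_nissues -> bool;
  budget : nat;
  threshold : rat;
  nvoters_gt0 : (0 < nvoters)%N;
  nissues_gt0 : (0 < nissues)%N;
  prob_01 : forall i j, 0 <= prob i j <= 1;
  prob_level : forall i j, (denq (prob i j) %| level.+1%:Z)%Z;
  cost_prob : forall i j s, admissible s = prob i j -> cost i j s = 0%N;
  cost_up : forall i j a b,
    prob i j <= admissible a -> admissible a <= admissible b ->
    (cost i j a <= cost i j b)%N;
  cost_down : forall i j a b,
    admissible b <= admissible a -> admissible a <= prob i j ->
    (cost i j a <= cost i j b)%N;
  threshold_01 : 0 <= threshold <= 1 }.

(* The default value [p] of the maximum and the minimum is itself an        *)
(* admissible value of price 0, by [prob_level] and [cost_prob].            *)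
Definition bribed_prob (I : vbam_instance) (d : 'I_(nvoters I) -> rat)
    (i : 'I_(nvoters I)) (j : 'I_(nissues I)) : rat :=
  let p := prob I i j in
  let affordable s := (cost i j s)%:R <= d i / (nissues I)%:R in
  if target j then
    \big[Num.max/p]_(s < (level I).+2 | (p <= admissible s) && affordable s)
      admissible s
  else
    \big[Num.min/p]_(s < (level I).+2 | (admissible s <= p) && affordable s)
      admissible s.

Definition won_AM (I : vbam_instance) (q : 'I_(nvoters I) -> 'I_(nissues I) -> rat)
    (j : 'I_(nissues I)) : Prop :=
  threshold I <
    (\sum_(i < nvoters I) (if target j then q i j else 1 - q i j))
    / (nvoters I)%:R.

Definition vbam_yes (I : vbam_instance) : Prop :=
  exists d : 'I_(nvoters I) -> rat,
    [/\ forall i, 0 <= d i,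
        \sum_(i < nvoters I) d i <= (budget I)%:R
      & forall j, won_AM (bribed_prob d) j].

(* No sign is needed: only rationals in [0, 1] are encoded. *)
Definition encode_rat (x : rat) : word := [:: `|numq x|%N; `|denq x|%N].

Definition vbam_encode (I : vbam_instance) : word :=
  [:: nvoters I; nissues I; level I; budget I]
  ++ encode_rat (threshold I)
  ++ flatten [seq encode_rat (prob I i j)
                | i <- enum 'I_(nvoters I), j <- enum 'I_(nissues I)]
  ++ flatten [seq [seq cost i j s | s <- enum 'I_(level I).+2]
                | i <- enum 'I_(nvoters I), j <- enum 'I_(nissues I)]
  ++ [seq nat_of_bool (target j) | j <- enum 'I_(nissues I)].

Definition VB_AM_Probabilistic_Lobbying : pproblem :=
  PProblem vbam_encode budget vbam_yes.

(* Main.v *)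
From mathcomp Require Import all_boot all_order all_algebra.
From mathcomp Require Import zify ring.
Require Import Defs.

Set Implicit Arguments.
Unset Strict Implicit.
Unset Printing Implicit Defensive.

(* Only floor (d_i / n) matters, so b = B / n (rounded down) units of money are
   distributed.  If n > B then b = 0 and nothing has to be guessed; otherwise both b
   and n are at most B.  Order the units by the voters they are spent on.  For every
   unit l and issue j, exactly one node (l, j, i, e, v) is selected: unit l is the
   e-th one spent on voter i and the score of issue j after it is (at least) v.  That
   the selection describes a bribery that wins every issue is a conjunction of
   conditions on pairs of nodes, so the circuit is the negation of a disjunction of
   binary conjunctions, of weft at most 2 and depth at most 3, with inputs of weight
   b * n <= B.

   The reduction is written in a small language of expressions with bounded sums and
   programs with bounded loops.  Loop bounds are variables, so when all variables are
   at most Q, the running time of the compiled program is polynomial in Q. *)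

(** * A loop language for the random access machine *)

(** The obstacle is arithmetic. Whether an issue is won depends on a sum over all voters, and what
    one unit buys depends on how many units its voter already has, since prices need not be linear.
    Conditions on pairs of nodes do not add up numbers, so running totals are guessed together with
    the units. Listing the units by voter makes the rank of a unit depend on its predecessor alone,
    so that every condition concerns nodes of the same unit or of consecutive units. A vector of
    totals for all issues would have exponentially many values; hence one node per unit and issue,
    with all nodes of a unit forced to agree on voter and rank.

    The candidates for a node stay few: a total is at most [m * (level + 1)], and [level] is below
    the length of the input because prices are listed for every admissible value. Ranks go up to
    [b], which may be exponential in the input length but is bounded by the parameter. *)

Inductive expr : Type :=
| Const (n : nat)
| Var (x : nat)
| Entry (a : expr)
| Add (a b : expr)
| Sub (a b : expr)
| Sum (x y : nat) (a : expr).

Fixpoint eval (w : word) (env : nat -> nat) (e : expr) : nat :=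
  match e with
  | Const n => n
  | Var x => env x
  | Entry a => nth 0 w (eval w env a)
  | Add a b => eval w env a + eval w env b
  | Sub a b => eval w env a - eval w env b
  | Sum x y a => \sum_(v < env y) eval w (upd env x v) a
  end.

Inductive stm : Type :=
| Emit (e : expr)
| Seq (p q : stm)
| If (e : expr) (p : stm)
| For (x y : nat) (p : stm).

Fixpoint out (w : word) (env : nat -> nat) (p : stm) : word :=
  match p with
  | Emit e => [:: eval w env e]
  | Seq p q => out w env p ++ out w env q
  | If e p => if eval w env e == 0 then [::] else out w env p
  | For x y p => flatten [seq out w (upd env x v) p | v <- iota 0 (env y)]
  end.

(** Even registers hold variables and odd ones scratch values. Thus [R[0]], which receives the input
    length and finally the output length, is variable 0. *)
Definition var (x : nat) : nat := x.*2.
Definition tmp (d : nat) : nat := d.*2.+1.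

(** The machine has no move instruction: a register is copied by adding one that contains 0. The
    loop variable is saved in [tmp d.+2] and restored at the end, [tmp d.+1] counts the rounds left,
    and [tmp d] starts at 0 as an accumulator for sums. *)
Definition loop (x y d : nat) (body : cmd) : cmd :=
  CSeq (CConst (tmp d) 0)
  (CSeq (CAdd (tmp d.+1) (var y) (tmp d))
  (CSeq (CAdd (tmp d.+2) (var x) (tmp d))
  (CSeq (CConst (var x) 0)
  (CSeq (CWhile (tmp d.+1)
          (CSeq body
          (CSeq (CAdd (var x) (var x) (tmp 2))
                (CSub (tmp d.+1) (tmp d.+1) (tmp 2)))))
  (CSeq (CConst (tmp d.+3) 0)
        (CAdd (var x) (tmp d.+2) (tmp d.+3))))))).

(** The result is left in [tmp d], and no lower scratch register is written. [Entry] compares the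
    address with the input length because the cells behind the input fill with output, whereas
    [eval] reads 0 there. *)
Fixpoint cexpr (d : nat) (e : expr) : cmd :=
  match e with
  | Const n => CConst (tmp d) n
  | Var x => CSeq (CConst (tmp d) 0) (CAdd (tmp d) (var x) (tmp d))
  | Entry a =>
      CSeq (cexpr d a)
      (CSeq (CSub (tmp d.+1) (tmp 1) (tmp d))
      (CIf (tmp d.+1) (CLoad (tmp d) (tmp d)) (CConst (tmp d) 0)))
  | Add a b =>
      CSeq (cexpr d a)
      (CSeq (cexpr d.+1 b) (CAdd (tmp d) (tmp d) (tmp d.+1)))
  | Sub a b =>
      CSeq (cexpr d a)
      (CSeq (cexpr d.+1 b) (CSub (tmp d) (tmp d) (tmp d.+1)))
  | Sum x y a =>
      loop x y d (CSeq (cexpr d.+3 a) (CAdd (tmp d) (tmp d) (tmp d.+3)))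
  end.

Fixpoint cstm (d : nat) (p : stm) : cmd :=
  match p with
  | Emit e =>
      CSeq (cexpr d e)
      (CSeq (CStore (tmp 0) (tmp d)) (CAdd (tmp 0) (tmp 0) (tmp 2)))
  | Seq p q => CSeq (cstm d p) (cstm d q)
  | If e p => CSeq (cexpr d e) (CIf (tmp d) (cstm d p) (CConst (tmp d) 0))
  | For x y p => loop x y d (cstm d.+3 p)
  end.

Fixpoint expr_cost (Q : nat) (e : expr) : nat :=
  match e with
  | Const _ => 1
  | Var _ => 2
  | Entry a => expr_cost Q a + 3
  | Add a b | Sub a b => expr_cost Q a + expr_cost Q b + 1
  | Sum _ _ a => Q * (expr_cost Q a + 4) + 7
  end.

Fixpoint stm_cost (Q : nat) (p : stm) : nat :=
  match p with
  | Emit e => expr_cost Q e + 2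
  | Seq p q => stm_cost Q p + stm_cost Q q
  | If e p => expr_cost Q e + stm_cost Q p + 2
  | For _ _ p => Q * (stm_cost Q p + 3) + 7
  end.

(** * Timed correctness of compiled expressions and programs *)

Definition runs (c : cmd) (s : state) (T : nat) (P : state -> Prop) : Prop :=
  exists t s', [/\ exec c s t s', t <= T & P s'].

Lemma runs_weaken c s T T' (P P' : state -> Prop) :
  runs c s T P -> T <= T' -> (forall s', P s' -> P' s') -> runs c s T' P'.
Proof.
move=> [t [s' [H1 H2 H3]]] le imp; exists t, s'; split=> //; last exact: imp.
exact: leq_trans le.
Qed.

Lemma runs_seq c1 c2 s T1 T2 (P R : state -> Prop) :
  runs c1 s T1 P -> (forall s', P s' -> runs c2 s' T2 R) ->
  runs (CSeq c1 c2) s (T1 + T2) R.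
Proof.
move=> [t [s' [H1 H2 H3]]] /(_ _ H3) [t' [s'' [H4 H5 H6]]].
exists (t + t'), s''; split=> //; first exact: exec_seq H1 H4.
exact: leq_add.
Qed.

(** The invariant is indexed by the value of the counter, that is, by the rounds left. Each round
    pays one step for its test, and the failing test costs one more. *)
Lemma runs_while x c T (I : nat -> state -> Prop) n s :
  (forall k s', I k s' -> reg s' x = k) ->
  (forall k s', I k.+1 s' -> runs c s' T (I k)) ->
  I n s -> runs (CWhile x c) s (n * T.+1 + 1) (I 0).
Proof.
move=> Ix step; elim: n s => [|n IHn] s Is.
  by exists 1, s; split=> //; apply: exec_while_stop; apply: Ix.
have [t [s' [H1 H2 /IHn [t' [s'' [H3 H4 H5]]]]]] := step _ _ Is.
exists (t + t').+1, s''; split=> //; last by rewrite mulSn; lia.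
by apply: exec_while_step H1 H3; rewrite (Ix _ _ Is).
Qed.

Lemma runs_const x v s P :
  P (set_reg s x v) -> runs (CConst x v) s 1 P.
Proof. by exists 1, (set_reg s x v); split=> //; apply: exec_const. Qed.

Lemma runs_add x y z s P :
  P (set_reg s x (reg s y + reg s z)) -> runs (CAdd x y z) s 1 P.
Proof. by eexists _, _; split; [apply: exec_add| |]. Qed.

Lemma runs_sub x y z s P :
  P (set_reg s x (reg s y - reg s z)) -> runs (CSub x y z) s 1 P.
Proof. by eexists _, _; split; [apply: exec_sub| |]. Qed.

Lemma runs_load x y s P :
  P (set_reg s x (mem s (reg s y))) -> runs (CLoad x y) s 1 P.
Proof. by eexists _, _; split; [apply: exec_load| |]. Qed.

Lemma runs_store x y s P :
  P (set_mem s (reg s x) (reg s y)) -> runs (CStore x y) s 1 P.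
Proof. by eexists _, _; split; [apply: exec_store| |]. Qed.

Lemma runs_if x c1 c2 s T P :
  (reg s x <> 0 -> runs c1 s T P) -> (reg s x = 0 -> runs c2 s T P) ->
  runs (CIf x c1 c2) s T.+1 P.
Proof.
move=> H1 H2; case: (eqVneq (reg s x) 0) => E.
  have [t [s' [? ? ?]]] := H2 E.
  by exists t.+1, s'; split=> //; apply: exec_if_false.
have [t [s' [? ? ?]]] := H1 (elimN eqP E).
by exists t.+1, s'; split=> //; apply: exec_if_true.
Qed.

(* [tmp 0] points behind the output, [tmp 1] holds the length of the input,
   [tmp 2] the constant 1; the output is built behind the input. *)
Record inv (w : word) (env : nat -> nat) (o : word) (s : state) : Prop := Inv {
  inv_var : forall x, reg s (var x) = env x;
  inv_ptr : reg s (tmp 0) = size w + size o;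
  inv_len : reg s (tmp 1) = size w;
  inv_one : reg s (tmp 2) = 1;
  inv_in : forall i, i < size w -> mem s i = nth 0 w i;
  inv_out : forall i, i < size o -> mem s (size w + i) = nth 0 o i }.

(** [tmp 0], [tmp 1] and [tmp 2] are excluded because [inv] governs them, and [tmp 0] moves with
    every number emitted. *)
Definition keeps (d : nat) (s s' : state) : Prop :=
  forall d', 2 < d' < d -> reg s' (tmp d') = reg s (tmp d').

Lemma keeps_trans d d' s1 s2 s3 :
  d <= d' -> keeps d s1 s2 -> keeps d' s2 s3 -> keeps d s1 s3.
Proof. by move=> dd H1 H2 i Hi; rewrite H2 ?H1 //; lia. Qed.

Lemma reg_set s x v y :
  reg (set_reg s x v) y = if y == x then v else reg s y.
Proof. by []. Qed.

Lemma tmp_eq d d' : (tmp d == tmp d') = (d == d').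
Proof. by rewrite /tmp; lia. Qed.

Lemma tmp_var d x : (tmp d == var x) = false.
Proof. by rewrite /tmp /var; lia. Qed.

Lemma var_tmp d x : (var x == tmp d) = false.
Proof. by rewrite /tmp /var; lia. Qed.

Lemma var_eq x y : (var x == var y) = (x == y).
Proof. by rewrite /var; lia. Qed.

Lemma tmp_eq0 d : (tmp d == 0) = false.
Proof. by []. Qed.

Lemma eq0_tmp d : (0 == tmp d) = false.
Proof. by []. Qed.

Definition regE := (reg_set, tmp_eq, tmp_eq0, eq0_tmp, tmp_var, var_tmp, var_eq).

Ltac regs := repeat (rewrite !regE /= || match goal with
  | |- context [@eq_op _ ?a ?b] =>
      first [have -> : (a == b) = true by lia | have -> : (a == b) = false by lia]
  end); rewrite /=.

Lemma inv_set_tmp w env o s d v :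
  2 < d -> inv w env o s -> inv w env o (set_reg s (tmp d) v).
Proof. by move=> d2 [H1 H2 H3 H4 H5 H6]; split=> // *; regs. Qed.

Lemma keeps_set_tmp d d' s s' v :
  d <= d' -> keeps d s s' -> keeps d s (set_reg s' (tmp d') v).
Proof. by move=> dd K i Hi; rewrite -K //; regs. Qed.

Lemma inv_set_var w env env' o s x v :
  (forall y, env' y = upd env x v y) ->
  inv w env o s -> inv w env' o (set_reg s (var x) v).
Proof.
by move=> E [H1 H2 H3 H4 H5 H6]; split=> // *; rewrite !regE // E H1.
Qed.

Lemma keeps_set_var d s s' x v :
  keeps d s s' -> keeps d s (set_reg s' (var x) v).
Proof. by move=> K i Hi; rewrite -K //; regs. Qed.

(* [A v] is the accumulator in [tmp d] and [O v] the output before the [v]-th round *)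
Lemma runs_loop w env (O : nat -> word) (A : nat -> nat) x y d body T s :
  2 < d -> inv w env (O 0) s -> A 0 = 0 ->
  (forall v s', v < env y -> inv w (upd env x v) (O v) s' -> reg s' (tmp d) = A v ->
     runs body s' T (fun s'' => [/\ inv w (upd env x v) (O v.+1) s'',
        keeps d s' s'', reg s'' (tmp d) = A v.+1,
        reg s'' (tmp d.+1) = reg s' (tmp d.+1) &
        reg s'' (tmp d.+2) = reg s' (tmp d.+2)])) ->
  runs (loop x y d body) s (env y * (T + 3) + 7)
    (fun s' => [/\ inv w env (O (env y)) s', keeps d s s' &
                   reg s' (tmp d) = A (env y)]).
Proof.
move=> d2 Is A0 Hbody.
set n := env y in Hbody *.
pose I k s' := [/\ k <= n, inv w (upd env x (n - k)) (O (n - k)) s', keeps d s s',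
  reg s' (tmp d) = A (n - k) & reg s' (tmp d.+1) = k /\ reg s' (tmp d.+2) = env x].
(* Four instructions set up the loop and two restore the variable. A round consists of the body, two
   counter updates and a test. *)
have -> : n * (T + 3) + 7 = 1 + (1 + (1 + (1 + ((n * (T + 2).+1 + 1) + (1 + 1))))).
  by rewrite -addnS; lia.
(* The intermediate assertion becomes equality with the resulting state, so that single instructions
   are executed symbolically. *)
apply: runs_seq; first by apply: runs_const; exact: erefl.
move=> _ <-; apply: runs_seq; first by apply: runs_add; exact: erefl.
move=> _ <-; apply: runs_seq; first by apply: runs_add; exact: erefl.
move=> _ <-; apply: runs_seq; first by apply: runs_const; exact: erefl.
move=> _ <-; apply: (@runs_seq _ _ _ _ _ (I 0)).
  apply: (@runs_while _ _ _ I).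
  - by move=> k s' [_ _ _ _ []].
  - move=> k s' [kn Is' Ks' As' [R1 R2]].
    have -> : T + 2 = T + (1 + 1) by lia.
    apply: (runs_seq (Hbody (n - k.+1) s' _ Is' As')); first by lia.
    move=> s1 [I1 K1 A1 R11 R12].
    apply: runs_seq; first by apply: runs_add; exact: erefl.
    move=> _ <-; apply: runs_sub; rewrite /I.
    have E1 : n - k = (n - k.+1).+1 by lia.
    split; first by lia.
    + apply: inv_set_tmp; first by lia.
      rewrite E1; apply: (inv_set_var _ I1) => z.
      by rewrite /upd (inv_var I1) (inv_one I1) /upd eqxx addn1; case: eqP.
    + apply: keeps_set_tmp; first by lia.
      by apply: keeps_set_var; exact: keeps_trans K1.
    + by regs; rewrite A1 E1.
    + by regs; rewrite R11 R12 R1 R2 (inv_one I1) subn1.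
  - rewrite /I subnn.
    split=> //.
    + apply: inv_set_var; first by [].
      by do !(apply: inv_set_tmp; first lia).
    + apply: keeps_set_var.
      by do !(apply: keeps_set_tmp; first lia).
    + by regs.
    + by regs; rewrite !addn0 !(inv_var Is).
move=> s1 [_ I1 K1 A1 [R1 R2]]; rewrite subn0 in I1 A1.
apply: runs_seq; first by apply: runs_const; exact: erefl.
move=> _ <-; apply: runs_add; split.
- apply: (@inv_set_var _ _ _ _ _ _ _ _ (inv_set_tmp _ _ I1)); last by lia.
  by move=> z; regs; rewrite addn0 R2 /upd; case: eqP => // ->.
- by apply: keeps_set_var; apply: keeps_set_tmp => //; lia.
- by regs.
Qed.

Lemma upd_le Q env x v :
  (forall y, env y <= Q) -> v <= Q -> forall y, upd env x v y <= Q.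
Proof. by move=> Henv Hv y; rewrite /upd; case: eqP. Qed.

Lemma runs_expr w Q e d env o s :
  2 < d -> (forall x, env x <= Q) -> inv w env o s ->
  runs (cexpr d e) s (expr_cost Q e)
    (fun s' => [/\ inv w env o s', keeps d s s' & reg s' (tmp d) = eval w env e]).
Proof.
elim: e d env s => [n|x|a IHa|a IHa b IHb|a IHa b IHb|x y a IHa] d env s d2 HQ Is /=.
- apply: runs_const; split; [exact: inv_set_tmp|exact: keeps_set_tmp|by regs].
- apply: (@runs_seq _ _ _ 1 1); first by apply: runs_const; exact: erefl.
  move=> _ <-; apply: runs_add; split.
  + by do !apply: inv_set_tmp.
  + by do !apply: keeps_set_tmp.
  + by regs; rewrite addn0 (inv_var Is).
- apply: (runs_seq (IHa d env s d2 HQ Is)) => s1 [I1 K1 R1].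
  apply: (@runs_seq _ _ _ 1 2); first by apply: runs_sub; exact: erefl.
  move=> _ <-; apply: runs_if; regs; rewrite (inv_len I1) R1 => H.
  + apply: runs_load; split.
    * by do !(apply: inv_set_tmp; first lia).
    * by do !(apply: keeps_set_tmp; first lia).
    * by regs; rewrite R1 (inv_in I1) //; lia.
  + apply: runs_const; split.
    * by do !(apply: inv_set_tmp; first lia).
    * by do !(apply: keeps_set_tmp; first lia).
    * by regs; rewrite nth_default //; lia.
- rewrite -addnA; apply: (runs_seq (IHa d env s d2 HQ Is)) => s1 [I1 K1 R1].
  apply: (runs_seq (IHb d.+1 env s1 _ HQ I1)); first by lia.
  move=> s2 [I2 K2 R2]; apply: runs_add; split.
  + exact: inv_set_tmp.
  + by apply: keeps_set_tmp => //; exact: keeps_trans K1 K2.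
  + by regs; rewrite R2 K2 ?R1 //; lia.
- rewrite -addnA; apply: (runs_seq (IHa d env s d2 HQ Is)) => s1 [I1 K1 R1].
  apply: (runs_seq (IHb d.+1 env s1 _ HQ I1)); first by lia.
  move=> s2 [I2 K2 R2]; apply: runs_sub; split.
  + exact: inv_set_tmp.
  + by apply: keeps_set_tmp => //; exact: keeps_trans K1 K2.
  + by regs; rewrite R2 K2 ?R1 //; lia.
- apply: (@runs_weaken _ _ (env y * (expr_cost Q a + 1 + 3) + 7)); last first.
  + by move=> s'; exact.
  + by rewrite -addnA leq_add2r leq_mul2r HQ orbT.
  apply: (@runs_loop _ _ (fun=> o) (fun n => \sum_(v < n) eval w (upd env x v) a)) => //.
    by rewrite big_ord0.
  move=> v s1 Hv I1 R1.
  apply: (runs_seq (IHa d.+3 _ s1 _ _ I1)); first by lia.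
    by apply: upd_le => //; apply: leq_trans (HQ y); exact: ltnW.
  move=> s2 [I2 K2 R2]; apply: runs_add; split.
  + exact: inv_set_tmp.
  + by apply: keeps_set_tmp => // i Hi; apply: K2; lia.
  + by regs; rewrite big_ord_recr /= R2 K2 ?R1 //; lia.
  + by regs; rewrite K2 //; lia.
  + by regs; rewrite K2 //; lia.
Qed.

Lemma inv_emit w env o s v :
  inv w env o s ->
  let s1 := set_mem s (reg s (tmp 0)) v in
  inv w env (rcons o v) (set_reg s1 (tmp 0) (reg s1 (tmp 0) + reg s1 (tmp 2))).
Proof.
move=> [H1 H2 H3 H4 H5 H6] s1; split.
- by move=> x; regs.
- by regs; rewrite H2 H4 size_rcons; lia.
- by regs.
- by regs.
- by move=> i Hi; rewrite /= /upd H2 ifF ?H5 //; lia.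
- move=> i; rewrite size_rcons ltnS leq_eqVlt /= /upd H2 nth_rcons => /orP[/eqP->|Hi].
    by rewrite eqxx ltnn eqxx.
  by rewrite Hi ifF ?H6 //; lia.
Qed.

Lemma runs_stm w Q p d env o s :
  2 < d -> (forall x, env x <= Q) -> inv w env o s ->
  runs (cstm d p) s (stm_cost Q p)
    (fun s' => inv w env (o ++ out w env p) s' /\ keeps d s s').
Proof.
elim: p d env o s => [e|p IHp q IHq|e p IHp|x y p IHp] d env o s d2 HQ Is /=.
- apply: (runs_seq (runs_expr e d2 HQ Is)) => s1 [I1 K1 R1].
  apply: (@runs_seq _ _ _ 1 1); first by apply: runs_store; exact: erefl.
  move=> _ <-; apply: runs_add; split.
    by rewrite cats1 -R1; exact: inv_emit.
  by move=> i Hi; rewrite -K1 //; regs.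
- apply: (runs_seq (IHp _ _ _ _ d2 HQ Is)) => s1 [I1 K1].
  apply: (runs_weaken (IHq _ _ _ _ d2 HQ I1)) => // s2 [I2 K2].
  by rewrite catA; split=> //; exact: keeps_trans K2.
- rewrite -addnA; apply: (runs_seq (runs_expr e d2 HQ Is)) => s1 [I1 K1 R1].
  rewrite addnS; apply: runs_if => H; rewrite -R1.
    apply: (runs_weaken (IHp _ _ _ _ d2 HQ I1)); first by rewrite leq_addr.
    move=> s2 [I2 K2]; rewrite (introF eqP H).
    by split=> //; exact: keeps_trans K2.
  apply: (@runs_weaken _ _ 1); last by move=> s2; exact.
    apply: runs_const; rewrite H cats0; split; first exact: inv_set_tmp.
    by apply: keeps_set_tmp.
  by rewrite addn1.
- apply: (@runs_weaken _ _ (env y * (stm_cost Q p + 3) + 7) _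
    (fun s' => [/\ inv w env (o ++ flatten [seq out w (upd env x v) p | v <- iota 0 (env y)]) s',
       keeps d s s' & reg s' (tmp d) = 0])).
  + apply: (@runs_loop _ _
      (fun n => o ++ flatten [seq out w (upd env x v) p | v <- iota 0 n]) (fun=> 0)) => //.
      by rewrite /= cats0.
    move=> v s1 Hv I1 R1.
    apply: (runs_weaken (IHp d.+3 _ _ s1 _ _ I1)) => //.
      by apply: upd_le => //; apply: leq_trans (HQ y); exact: ltnW.
    move=> s2 [I2 K2]; split.
    * by rewrite -addn1 iotaD map_cat flatten_cat /= cats0 catA.
    * by move=> i Hi; apply: K2; lia.
    * by rewrite K2 //; lia.
    * by rewrite K2 //; lia.
    * by rewrite K2 //; lia.
  + by rewrite leq_add2r leq_mul2r HQ orbT.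
  + by move=> s' [].
Qed.

(** * Initial assignments and whole programs *)

Definition sets := seq (nat * expr).

(** Derived numbers such as products are stored in variables before the main program starts, since
    only variables can bound a loop. Later assignments see the earlier ones. *)
Fixpoint set_env (w : word) (env : nat -> nat) (l : sets) : nat -> nat :=
  if l is (x, e) :: l' then set_env w (upd env x (eval w env e)) l' else env.

Fixpoint sets_le (Q : nat) (w : word) (env : nat -> nat) (l : sets) : Prop :=
  if l is (x, e) :: l' then
    eval w env e <= Q /\ sets_le Q w (upd env x (eval w env e)) l'
  else True.

Fixpoint csets (l : sets) (c : cmd) : cmd :=
  if l is (x, e) :: l' then
    CSeq (cexpr 3 e)
    (CSeq (CConst (tmp 4) 0)
    (CSeq (CAdd (var x) (tmp 3) (tmp 4)) (csets l' c)))
  else c.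

Definition sets_cost (Q : nat) (l : sets) (T : nat) : nat :=
  foldr (fun xe t => expr_cost Q xe.2 + (1 + (1 + t))) T l.

Lemma runs_sets w Q l c T P env s :
  (forall x, env x <= Q) -> sets_le Q w env l -> inv w env [::] s ->
  (forall s', (forall x, set_env w env l x <= Q) ->
     inv w (set_env w env l) [::] s' -> runs c s' T P) ->
  runs (csets l c) s (sets_cost Q l T) P.
Proof.
elim: l env s => [|[x e] l IHl] env s HQ /= Hl Is Hc; first exact: Hc.
have [le_e Hl'] := Hl.
apply: (runs_seq (runs_expr e (isT : 2 < 3) HQ Is)) => s1 [I1 K1 R1].
apply: runs_seq; first by apply: runs_const; exact: erefl.
move=> _ <-; apply: runs_seq; first by apply: runs_add; exact: erefl.
move=> _ <-; apply: IHl Hl' _ Hc; first exact: upd_le.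
apply: (inv_set_var _ (inv_set_tmp 0 _ I1)) => // z; regs.
by rewrite R1 addn0.
Qed.

(* Source and destination may overlap, but the destination is the lower one. *)
Definition copy : cmd :=
  CSeq (CConst (tmp 3) 0)
  (CSeq (CSub 0 (tmp 0) (tmp 1))
  (CSeq (CAdd (tmp 4) 0 (tmp 3))
  (CWhile (tmp 4)
    (CSeq (CLoad (tmp 5) (tmp 1))
    (CSeq (CStore (tmp 3) (tmp 5))
    (CSeq (CAdd (tmp 1) (tmp 1) (tmp 2))
    (CSeq (CAdd (tmp 3) (tmp 3) (tmp 2))
          (CSub (tmp 4) (tmp 4) (tmp 2))))))))).

Lemma runs_copy w env o s :
  inv w env o s ->
  runs copy s (size o * 6 + 4)
    (fun s' => reg s' 0 = size o /\ forall i, i < size o -> mem s' i = nth 0 o i).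
Proof.
move=> [H1 H2 H3 H4 H5 H6]; set n := size o.
have -> : n * 6 + 4 = 1 + (1 + (1 + (n * 6 + 1))) by lia.
apply: runs_seq; first by apply: runs_const; exact: erefl.
move=> _ <-; apply: runs_seq; first by apply: runs_sub; exact: erefl.
move=> _ <-; apply: runs_seq; first by apply: runs_add; exact: erefl.
pose I k s' := [/\ k <= n, reg s' 0 = n,
  [/\ reg s' (tmp 1) = size w + (n - k), reg s' (tmp 3) = n - k, reg s' (tmp 4) = k
    & reg s' (tmp 2) = 1],
  forall i, i < n - k -> mem s' i = nth 0 o i
  & forall i, n - k <= i < n -> mem s' (size w + i) = nth 0 o i].
move=> _ <-; apply: (@runs_weaken _ _ (n * 6 + 1) _ (I 0)) => //; last first.
  by move=> s' [_ R0 _ Hm _]; split=> // i Hi; apply: Hm; rewrite subn0.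
apply: (@runs_while _ _ _ I).
- by move=> k s' [_ _ []].
- move=> k s' [kn R0 [R1 R3 R4 R2] Hm Ho].
  apply: (@runs_seq _ _ _ 1 4); first by apply: runs_load; exact: erefl.
  move=> _ <-; apply: (@runs_seq _ _ _ 1 3); first by apply: runs_store; exact: erefl.
  move=> _ <-; apply: (@runs_seq _ _ _ 1 2); first by apply: runs_add; exact: erefl.
  move=> _ <-; apply: (@runs_seq _ _ _ 1 1); first by apply: runs_add; exact: erefl.
  move=> _ <-; apply: runs_sub; split.
  + by lia.
  + by regs.
  + by split; regs; rewrite ?R1 ?R2 ?R3 ?R4; lia.
  + move=> i Hi; regs; rewrite /upd; regs; rewrite R3 R1.
    by case: eqP => [->|ne]; [rewrite Ho //; lia|rewrite Hm //; lia].
  (* A source cell still to be read is [size w + i] with [i] above the current destination, so the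
     write misses it. *)
  + move=> i Hi; regs; rewrite /upd; regs.
    by rewrite Ho //; lia.
- rewrite /I subnn; split=> //.
  + by regs; rewrite H2 H3 /n; lia.
  + by split; regs; rewrite ?H2 ?H3 ?addn0 ?addKn.
Qed.

(** [tmp 0] still contains 0 when the input length is copied to [tmp 1]; only afterwards does it
    become the output pointer, just behind the input. *)
Definition compile (l : sets) (p : stm) : cmd :=
  CSeq (CConst (tmp 2) 1)
  (CSeq (CAdd (tmp 1) 0 (tmp 0))
  (CSeq (CAdd (tmp 0) 0 (tmp 0))
        (csets l (CSeq (cstm 3 p) copy)))).

Definition size_env (w : word) : nat -> nat := fun x => if x == 0 then size w else 0.

(** Every number emitted costs time. This bounds both the final copy and the output length that
    [computes_within] charges for. *)
Lemma size_out w Q p env : (forall x, env x <= Q) -> size (out w env p) <= stm_cost Q p.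
Proof.
elim: p env => [e|p IHp q IHq|e p IHp|x y p IHp] env HQ //=.
- by rewrite addn2.
- by rewrite size_cat leq_add ?IHp ?IHq.
- by case: ifP => // _; have := IHp _ HQ; lia.
- rewrite size_flatten /shape -map_comp.
  have H : forall v, v < env y -> size (out w (upd env x v) p) <= stm_cost Q p.
    move=> v Hv; apply: IHp; apply: upd_le => //.
    by apply: leq_trans (HQ y); exact: ltnW.
  apply: (@leq_trans (env y * stm_cost Q p)).
    have : all (fun v => v < env y) (iota 0 (env y)).
      by apply/allP => v; rewrite mem_iota.
    rewrite -[X in X * _](size_iota 0); elim: (iota _ _) => //= v r IHr /andP[vy ry].
    by rewrite mulSn leq_add ?H ?IHr.
  by have := HQ y; nia.
Qed.

(** The factor 7 is one share for running [p] and six for copying at most [stm_cost Q p] numbers to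
    the front. *)
Lemma compile_computes w Q l p :
  size w <= Q -> sets_le Q w (size_env w) l ->
  computes_within (compile l p) w
    (3 + sets_cost Q l (stm_cost Q p * 7 + 4)) (out w (set_env w (size_env w) l) p).
Proof.
move=> wQ lQ; set env := set_env _ _ _.
have E0 x : size_env w x <= Q by rewrite /size_env; case: eqP.
suff [t [s [He Ht [[Hs Hm] HQ]]]] : runs (compile l p) (init_state w)
    (3 + sets_cost Q l (stm_cost Q p * 7 + 4))
    (fun s => (reg s 0 = size (out w env p) /\
      forall i, i < size (out w env p) -> mem s i = nth 0 (out w env p) i) /\
      forall x, env x <= Q).
  exists t, s; split=> //; split=> //; apply: leq_trans (size_out w p HQ) _.
  suff : stm_cost Q p * 7 + 4 <= sets_cost Q l (stm_cost Q p * 7 + 4) by lia.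
  rewrite /sets_cost; elim: (l) => //= a l' /leq_trans; apply; lia.
apply: (@runs_seq _ _ _ 1); first by apply: runs_const; exact: erefl.
move=> _ <-; apply: (@runs_seq _ _ _ 1); first by apply: runs_add; exact: erefl.
move=> _ <-; apply: (@runs_seq _ _ _ 1); first by apply: runs_add; exact: erefl.
move=> _ <-; apply: (runs_sets E0 lQ).
  split=> //; try by regs; rewrite /= ?addn0.
  by move=> x; regs; rewrite /size_env /var double_eq0.
move=> s HQ Is.
apply: (@runs_weaken _ _ (stm_cost Q p + (stm_cost Q p * 6 + 4))); last by move=> s'; exact.
  apply: (runs_seq (runs_stm p (isT : 2 < 3) HQ Is)) => s1 [I1 _].
  apply: (runs_weaken (runs_copy I1)) => //.
  by rewrite leq_add2r leq_mul2r /= size_out.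
by lia.
Qed.

(** * Polynomial bounds on running times *)

Definition poly_bounded (F : nat -> nat) : Prop :=
  exists A D, forall Q, F Q <= A * Q.+1 ^ D.

Lemma poly_bounded_const c : poly_bounded (fun=> c).
Proof. by exists c, 0 => Q; rewrite muln1. Qed.

Lemma poly_bounded_id : poly_bounded id.
Proof. by exists 1, 1 => Q; rewrite mul1n expn1. Qed.

Lemma poly_boundedD F F' :
  poly_bounded F -> poly_bounded F' -> poly_bounded (fun Q => F Q + F' Q).
Proof.
move=> [A [D H]] [A' [D' H']]; exists (A + A'), (D + D') => Q; rewrite mulnDl.
apply: leq_add; [apply: leq_trans (H Q) _|apply: leq_trans (H' Q) _];
  by rewrite leq_mul2l leq_pexp2l ?leq_addl ?leq_addr ?orbT.
Qed.

Lemma poly_boundedM F F' :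
  poly_bounded F -> poly_bounded F' -> poly_bounded (fun Q => F Q * F' Q).
Proof.
move=> [A [D H]] [A' [D' H']]; exists (A * A'), (D + D') => Q.
by rewrite expnD mulnACA leq_mul.
Qed.

Lemma expr_cost_poly e : poly_bounded (expr_cost^~ e).
Proof.
elim: e => /= *; do ?[apply: poly_boundedD|apply: poly_boundedM|exact: poly_bounded_id
  |exact: poly_bounded_const|assumption].
Qed.

Lemma stm_cost_poly p : poly_bounded (stm_cost^~ p).
Proof.
elim: p => /= *; do ?[apply: poly_boundedD|apply: poly_boundedM|exact: poly_bounded_id
  |exact: poly_bounded_const|exact: expr_cost_poly|assumption].
Qed.

Lemma sets_cost_poly l F : poly_bounded F -> poly_bounded (fun Q => sets_cost Q l (F Q)).
Proof.
move=> HF; elim: l => [|[x e] l IHl] //=.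
by do ?[apply: poly_boundedD|exact: expr_cost_poly|exact: poly_bounded_const|assumption].
Qed.

Lemma compile_poly l p :
  poly_bounded (fun Q => 3 + sets_cost Q l (stm_cost Q p * 7 + 4)).
Proof.
apply: poly_boundedD; first exact: poly_bounded_const.
apply: sets_cost_poly; apply: poly_boundedD; last exact: poly_bounded_const.
apply: poly_boundedM; [exact: stm_cost_poly|exact: poly_bounded_const].
Qed.

(** * Allocations of money as chains *)

(* An allocation of [b] units of money is a nondecreasing sequence of voters;
   [(i, e)] says that the current unit is the [e]-th one spent on voter [i]. *)
Definition step (p q : nat * nat) : bool :=
  (q.1 == p.1) && (q.2 == p.2.+1) || (p.1 < q.1) && (q.2 == 1).

Lemma sum_upd (m i : nat) (E G : nat -> nat) :
  i < m -> (forall i', i' != i -> G i' = E i') ->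
  \sum_(k < m) G k + E i = \sum_(k < m) E k + G i.
Proof.
move=> im H; rewrite (bigD1 (Ordinal im)) //= [in RHS](bigD1 (Ordinal im)) //=.
rewrite (eq_bigr (fun k : 'I_m => E k)) => [|k]; first by lia.
by rewrite -val_eqE => /H.
Qed.

Section Chain.

Variables (m n b : nat) (sc : nat -> nat -> nat -> nat) (win : nat -> bool).

Definition score (E : nat -> nat) (j : nat) : nat := \sum_(i < m) sc i j (E i).

Hypothesis m_gt0 : 0 < m.
Hypothesis sc_mono : forall i j e e', e <= e' -> sc i j e <= sc i j e'.
Hypothesis win_up : forall x y, x <= y -> win x -> win y.

(** The total may rise from [x] to [y] by at most what the last unit adds, written without cut-off
    subtraction. An inequality suffices: totals that are too low do no harm because [win] is upward
    closed. *)
Definition gain_ok (j : nat) (q : nat * nat) (x y : nat) : bool :=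
  y + sc q.1 j q.2.-1 <= x + sc q.1 j q.2.

Definition chain (c : nat -> nat * nat) (v : nat -> nat -> nat) : Prop :=
  [/\ forall l, l < b -> (c l).1 < m /\ (c l).2 <= b,
      forall l, l.+1 < b -> step (c l) (c l.+1),
      0 < b -> (c 0).2 = 1,
      forall j, j < n -> 0 < b -> gain_ok j (c 0) (score (fun=> 0) j) (v 0 j) &
      forall l j, j < n -> l.+1 < b -> gain_ok j (c l.+1) (v l j) (v l.+1 j)].

Lemma score_upd E G i j :
  i < m -> (forall i', i' != i -> G i' = E i') ->
  score G j + sc i j (E i) = score E j + sc i j (G i).
Proof.
move=> im H; apply: (@sum_upd m i (fun k => sc k j (E k)) (fun k => sc k j (G k))) => //.
by move=> k /H ->.
Qed.

(** Induction on the prefix of units. The invariant that voters beyond the current one have received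
    nothing is what allows the rank to restart at 1 when the chain moves to a later voter. *)
Lemma chain_alloc c v l :
  chain c v -> l < b -> exists E : nat -> nat,
    [/\ \sum_(i < m) E i = l.+1, E (c l).1 = (c l).2,
        forall i, (c l).1 < i -> E i = 0 &
        forall j, j < n -> v l j <= score E j].
Proof.
move=> [c_le c_step c0 g0 g_step]; elim: l => [|l IHl] lb.
  have [cm _] := c_le 0 lb.
  pose G := upd (fun=> 0) (c 0).1 1.
  have GE i' : i' != (c 0).1 -> G i' = 0 by rewrite /G /upd => /negbTE ->.
  have Gq : G (c 0).1 = 1 by rewrite /G /upd eqxx.
  exists G; split.
  - by have := sum_upd cm GE; rewrite Gq addn0 [X in _ = X + _]big1.
  - by rewrite Gq c0.
  - by move=> i Hi; apply: GE; rewrite neq_ltn Hi orbT.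
  - move=> j jn; have := g0 j jn lb; rewrite /gain_ok c0 //=.
    by have := score_upd j cm GE; rewrite Gq /=; lia.
have [E [E1 E2 E3 E4]] := IHl (ltnW lb).
have [cm _] := c_le _ lb.
set q := c l.+1 in cm *.
pose G := upd E q.1 q.2.
have GE i' : i' != q.1 -> G i' = E i' by rewrite /G /upd => /negbTE ->.
have Gq : G q.1 = q.2 by rewrite /G /upd eqxx.
have st := c_step l lb.
(* Either the voter stays and its rank grows by one, or the new voter lies beyond the current one
   and had 0. *)
have Eq : E q.1 = q.2.-1 /\ 0 < q.2.
  rewrite -/q in st; case/orP: (st) => /andP[Ha /eqP Hb]; last by rewrite E3 // Hb.
  by rewrite (eqP Ha) Hb E2.
have qm : forall i, q.1 < i -> (c l).1 < i.
  by move=> i; case/orP: st => /andP[] => [/eqP -> //|Ha _]; apply: ltn_trans.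
exists G; split=> //.
- by have := sum_upd cm GE; rewrite E1 Gq Eq.1; lia.
- by move=> i Hi; rewrite GE ?E3 ?qm // neq_ltn Hi orbT.
- move=> j jn; have := g_step l j jn lb; rewrite /gain_ok.
  have := score_upd j cm GE; rewrite Gq Eq.1 -/q; have := E4 j jn; lia.
Qed.

Lemma exists_alloc_list (E : nat -> nat) :
  exists s : seq nat, [/\ sorted leq s, size s = \sum_(i < m) E i,
    all (fun i => i < m) s & forall i, i < m -> count_mem i s = E i].
Proof.
pose t := flatten [seq nseq (E i) i | i <- iota 0 m].
have sz : size t = \sum_(i < m) E i.
  rewrite size_flatten /shape -map_comp sumnE big_map -(big_mkord xpredT) /index_iota subn0.
  by apply: eq_bigr => i _ /=; rewrite size_nseq.
exists (sort leq t); split.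
- by apply: sort_sorted; exact: leq_total.
- by rewrite size_sort.
- rewrite all_sort; apply/allP => x /flattenP[s /mapP[i]].
  by rewrite mem_iota => /andP[_ im] -> /nseqP[-> _].
- move=> i im; rewrite count_sort count_flatten -map_comp sumnE big_map.
  rewrite (bigD1_seq i) ?iota_uniq ?mem_iota //= count_nseq /= eqxx mul1n.
  by rewrite big1 ?addn0 // => k /negbTE ki; rewrite count_nseq /= ki.
Qed.

(** The units are the entries of a sorted list of voters. The rank of a unit is the multiplicity of
    its voter in the prefix ending there, and the totals are the exact scores of the prefixes. Being
    scores, they stay in the range that node numbers can represent. *)
Lemma alloc_chain (E : nat -> nat) :
  \sum_(i < m) E i = b -> exists c v,
    [/\ chain c v, forall l j, exists G : nat -> nat, v l j = score G j &
        forall j, 0 < b -> v b.-1 j = score E j].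
Proof.
move=> Eb; have [s [s_sorted s_size s_lt s_count]] := exists_alloc_list E.
rewrite Eb in s_size.
pose F l i := count_mem i (take l s).
pose c l := (nth 0 s l, F l.+1 (nth 0 s l)).
have FS l i : l < b -> F l.+1 i = F l i + (nth 0 s l == i).
  move=> lb; rewrite /F (take_nth 0) ?s_size // -cats1 count_cat /=; lia.
have Fne l i : l < b -> i != (c l).1 -> F l.+1 i = F l i.
  by move=> lb; rewrite FS // eq_sym => /negbTE ->; rewrite addn0.
have Feq l : l < b -> F l.+1 (c l).1 = (F l (c l).1).+1.
  by move=> lb; rewrite FS // eqxx addn1.
have cm l : l < b -> (c l).1 < m.
  by move=> lb; apply: (allP s_lt); rewrite mem_nth ?s_size.
have gain l j : l < b -> gain_ok j (c l) (score (F l) j) (score (F l.+1) j).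
  move=> lb; have := score_upd j (cm l lb) (fun i => @Fne l i lb).
  by rewrite /gain_ok (_ : (c l).2 = F l.+1 (c l).1) // Feq // -pred_Sn; lia.
have F0 i : F 0 i = 0 by rewrite /F take0.
exists c, (fun l => score (F l.+1)); split=> [|l j|j b0].
- split=> [l lb|l lb|b0|j jn b0|l j jn lb]; last exact: gain.
  + split; first exact: cm.
    apply: leq_trans (count_size _ _) _; rewrite size_take s_size.
    by case: ifP => _; lia.
  + rewrite /step /=; case: (eqVneq (nth 0 s l.+1) (nth 0 s l)) => [eq|ne] /=.
      by rewrite (FS l.+1) // eqxx addn1 eq eqxx.
    have lt : nth 0 s l < nth 0 s l.+1.
      rewrite ltn_neqAle eq_sym ne /=.
      by rewrite (sorted_leq_nth leq_trans leqnn) // ?inE ?s_size //; lia.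
    rewrite lt /= FS // eqxx addn1 eqSS /F; apply/eqP.
    (* In a sorted list a strictly larger entry has no earlier occurrence, so its rank is 1. *)
    apply/count_memPn/negP => /(nthP 0)[k].
    rewrite size_takel ?s_size ?(ltnW lb) // => kl.
    rewrite nth_take // => Hk; move: lt; rewrite -Hk ltnNge.
    by rewrite (sorted_leq_nth leq_trans leqnn) // ?inE ?s_size //; lia.
  + by rewrite /c /= (Feq 0 b0) F0.
  + have -> : score (fun=> 0) j = score (F 0) j by apply: eq_bigr => i _; rewrite F0.
    exact: gain.
- by exists (F l.+1).
- apply: eq_bigr => i _; rewrite prednK // /F take_oversize ?s_size // s_count //.
Qed.

(** A chain spends exactly [b] units. Money left over goes to voter 0, which lowers no score by
    monotonicity. *)
Lemma alloc_pad (E : nat -> nat) : \sum_(i < m) E i <= b ->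
  exists G : nat -> nat, \sum_(i < m) G i = b /\ forall j, score E j <= score G j.
Proof.
move=> Eb; pose G := upd E 0 (E 0 + (b - \sum_(i < m) E i)).
have GE i : i != 0 -> G i = E i by rewrite /G /upd => /negbTE ->.
have G0 : G 0 = E 0 + (b - \sum_(i < m) E i) by [].
exists G; split.
  by have := sum_upd m_gt0 GE; rewrite G0; lia.
move=> j; have := score_upd j m_gt0 GE.
have : sc 0 j (E 0) <= sc 0 j (G 0) by apply: sc_mono; rewrite G0 leq_addr.
by lia.
Qed.

(** Without units there is no last total [v b.-1 j] to inspect, hence the separate condition for
    [b = 0]. *)
Lemma chain_of_alloc (E0 : nat -> nat) :
  \sum_(i < m) E0 i <= b -> (forall j, j < n -> win (score E0 j)) ->
  (b = 0 -> forall j, j < n -> win (score (fun=> 0) j)) /\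
  exists c v, [/\ chain c v, forall l j, exists G : nat -> nat, v l j = score G j &
     forall j, j < n -> 0 < b -> win (v b.-1 j)].
Proof.
move=> /alloc_pad[E [Eb le]] w0.
have w j : j < n -> win (score E j) by move=> /w0; apply: win_up.
split=> [b0 j jn|].
  have <- : score E j = score (fun=> 0) j; last exact: w.
  apply: eq_bigr => i _; congr sc; apply/eqP.
  by rewrite -leqn0 -b0 -Eb (bigD1 i) //= leq_addr.
have [c [v [cv vG vb]]] := alloc_chain Eb.
by exists c, v; split=> // j jn b0; rewrite vb // w.
Qed.

Lemma alloc_of_chain c v :
  (b = 0 -> forall j, j < n -> win (score (fun=> 0) j)) ->
  chain c v -> (forall j, j < n -> 0 < b -> win (v b.-1 j)) ->
  exists E : nat -> nat, \sum_(i < m) E i <= b /\ forall j, j < n -> win (score E j).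
Proof.
move=> w0 cv w; case: (posnP b) => [b0|b_gt0].
  by exists (fun=> 0); split; [rewrite big1|exact: w0].
have [|E [E1 _ _ E4]] := @chain_alloc c v b.-1 cv; first by rewrite prednK.
exists E; split; first by rewrite E1 prednK.
by move=> j jn; apply: win_up (E4 j jn) _; exact: w.
Qed.

End Chain.

(** * Circuits from forbidden pairs *)

(** A clause lists inputs that must not all be true. An empty clause is an empty conjunction and
    makes the circuit constantly false. *)
Definition clause_circuit (N : nat) (cs : seq (seq nat)) : circuit :=
  Circuit N ([seq GAnd c | c <- cs] ++ [:: GOr (iota N (size cs)); GNot (N + size cs)]).

Definition clauses_ok (N : nat) (cs : seq (seq nat)) : bool :=
  all (fun c => (size c <= 2) && all (fun u => u < N) c) cs.

Section ClauseCircuit.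

Variables (N : nat) (cs : seq (seq nat)).
Hypothesis csP : clauses_ok N cs.

(** Value, weft and depth are computed by folds of the same shape. Gates that read only the initial
    nodes [vs] do not depend on one another, so the fold becomes a map. *)
Lemma foldl_rcons_map T (F : seq T -> gate -> T) (vs : seq T) (G : seq nat -> T) cs' :
  (forall c t, c \in cs' -> F (vs ++ t) (GAnd c) = G c) ->
  foldl (fun vs g => rcons vs (F vs g)) vs [seq GAnd c | c <- cs'] = vs ++ map G cs'.
Proof.
elim/last_ind: cs' => [|cs' c IH] H; first by rewrite cats0.
rewrite !map_rcons foldl_rcons IH ?H ?rcons_cat ?mem_rcons ?inE ?eqxx //.
by move=> c' t Hc; apply: H; rewrite mem_rcons inE Hc orbT.
Qed.

Lemma clause_lt c u : c \in cs -> u \in c -> u < N.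
Proof. by move=> /(allP csP)/andP[_ /allP]; apply. Qed.

Lemma clause_circuit_wf : circuit_wf (clause_circuit N cs).
Proof.
apply/andP; split; first by rewrite /= size_cat /= !addnS.
apply/forallP => -[i /=]; rewrite size_cat size_map /= addn2 => Hi.
rewrite nth_cat size_map; case: ltnP => His.
  rewrite (nth_map [::]) //=; apply/allP => u /clause_lt H.
  by apply: leq_trans (H _) (leq_addr _ _); rewrite mem_nth.
have [->|->] : i = size cs \/ i = (size cs).+1 by lia.
  by rewrite subnn /=; apply/allP => u; rewrite mem_iota => /andP[].
by rewrite subSnn /= andbT addnS.
Qed.

(** Conjunctions of at most two inputs and the negation are not large; only the disjunction can
    count. *)
Lemma clause_circuit_weft : weft (clause_circuit N cs) <= 2.
Proof.
rewrite /weft foldl_cat (@foldl_rcons_map _ _ _ (fun=> 0)).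
  set ws := nseq N 0 ++ _; have ws0 u : nth 0 ws u = 0.
    have : all (pred1 0) ws by rewrite all_cat all_pred1_nseq all_map; apply/allP.
    move=> /(all_nthP 0) H; case: (ltnP u (size ws)) => [/H/eqP //|]; exact: nth_default.
  have sz : size ws = N + size cs by rewrite size_cat size_nseq size_map.
  rewrite /= last_rcons big_seq1 nth_rcons sz ltnn eqxx big1 ?addn0 //.
  by case: large.
move=> c t Hc /=; have /andP[c2 /allP cN] := allP csP c Hc.
rewrite /large ltnNge c2 /= big_seq big1 // => u /cN uN.
by rewrite nth_cat size_nseq uN nth_nseq uN.
Qed.

Lemma clause_circuit_depth : depth (clause_circuit N cs) <= 3.
Proof.
rewrite /depth foldl_cat (@foldl_rcons_map _ _ _ (fun=> 1)).
  set ws := nseq N 0 ++ _; have ws1 u : nth 0 ws u <= 1.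
    have : all (geq 1) ws by rewrite all_cat all_nseq all_map orbT; apply/allP.
    move=> /(all_nthP 0) H; case: (ltnP u (size ws)) => [/H //|H']; by rewrite nth_default.
  have sz : size ws = N + size cs by rewrite size_cat size_nseq size_map.
  rewrite /= last_rcons big_seq1 nth_rcons sz ltnn eqxx !ltnS.
  by apply/bigmax_leqP_seq => u _ _; exact: ws1.
move=> c t Hc /=; have /andP[c2 /allP cN] := allP csP c Hc.
rewrite big_seq big1 // => u /cN uN.
by rewrite nth_cat size_nseq uN nth_nseq uN.
Qed.

Lemma clause_circuit_value (a : N.-tuple bool) :
  circuit_value (C := clause_circuit N cs) a = all (fun c => ~~ all (nth false a) c) cs.
Proof.
rewrite /circuit_value foldl_cat (@foldl_rcons_map _ _ _ (all (nth false a))).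
  set vs := val a ++ _; have sz : size vs = N + size cs by rewrite size_cat size_tuple size_map.
  rewrite /= last_rcons nth_rcons sz ltnn eqxx.
  have E : map (nth false vs) (iota N (size cs)) = map (all (nth false a)) cs.
    apply: (@eq_from_nth _ false); rewrite !size_map ?size_iota // => i Hi.
    rewrite (nth_map 0) ?size_iota // nth_iota // nth_cat size_tuple ltnNge leq_addr /=.
    by rewrite addKn.
  by have := has_map (nth false vs) id (iota N (size cs)); rewrite E has_map all_predC => ->.
move=> c t Hc /=; apply: eq_in_all => u /(clause_lt Hc) uN.
by rewrite nth_cat size_tuple uN.
Qed.

End ClauseCircuit.

(** The inputs form [K] blocks of [D] nodes, and each block is a clique of forbidden pairs. A
    selection of weight exactly [K] therefore takes one node from every block, which makes it a
    function of the block. *)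
Lemma indep_set (K D : nat) (forb : rel nat) :
  0 < D ->
  (forall u u', u %/ D = u' %/ D -> u != u' -> forb u u') ->
  (exists a : (K * D).-tuple bool, count id a = K /\
     forall u u', u < K * D -> u' < K * D -> forb u u' -> ~~ (nth false a u && nth false a u'))
  <-> exists f : nat -> nat, (forall g, g < K -> f g %/ D = g) /\
     forall g g', g < K -> g' < K -> ~~ forb (f g) (f g').
Proof.
move=> D0 same; split=> [[a [aK af]]|[f [fD ff]]].
  pose A := [seq u <- iota 0 (K * D) | nth false a u].
  have AP u : (u \in A) = (u < K * D) && nth false a u.
    by rewrite mem_filter mem_iota andbC.
  have sA : size A = K.
    rewrite -aK size_filter -[X in _ = count id X](mkseq_nth false) size_tuple count_map.
    by apply: eq_count.
  pose B := map (fun u => u %/ D) A.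
  (* Pigeonhole: [K] distinct block numbers below [K] exhaust them all. *)
  have BI : B =i iota 0 K.
    apply: (@uniq_min_size _ _ _ _ _ _).2.
    - rewrite map_inj_in_uniq ?filter_uniq ?iota_uniq // => u u'.
      rewrite !AP => /andP[uN au] /andP[uN' au'] uu'; apply/eqP/negPn/negP => ne.
      by have := af u u' uN uN' (same _ _ uu' ne); rewrite au au'.
    - by move=> _ /mapP[u + ->]; rewrite AP mem_iota => /andP[]; rewrite ltn_divLR.
    - by rewrite size_iota size_map sA.
  pose f g := nth 0 A (index g B).
  have fA g : g < K -> f g \in A /\ f g %/ D = g.
    move=> gK; have gB : g \in B by rewrite BI mem_iota.
    have iA : index g B < size A by rewrite -(size_map (fun u => u %/ D)) index_mem.
    by split; [exact: mem_nth|have := nth_index 0 gB; rewrite (nth_map 0)].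
  exists f; split=> [g /fA[]//|g g' /fA[+ _] /fA[+ _]].
  rewrite !AP => /andP[uN au] /andP[uN' au']; apply/negP => /(af _ _ uN uN').
  by rewrite au au'.
have fN g : g < K -> f g < K * D by move=> gK; rewrite -ltn_divLR // fD.
pose a := [tuple f (i %/ D) == i :> nat | i < K * D].
have aP u : u < K * D -> nth false a u = (f (u %/ D) == u).
  by move=> uN; have := tnth_mktuple (fun i : 'I__ => f (i %/ D) == i :> nat) (Ordinal uN);
     rewrite (tnth_nth false).
exists a; split=> [|u u' uN uN' uu']; last first.
  rewrite !aP //; apply/negP => /andP[/eqP fu /eqP fu'].
  have /negP[] : ~~ forb (f (u %/ D)) (f (u' %/ D)) by rewrite ff // ltn_divLR.
  by rewrite fu fu'.
have -> : count id a = size [seq u <- iota 0 (K * D) | f (u %/ D) == u].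
  rewrite size_filter -[X in count id X](mkseq_nth false) size_tuple count_map.
  by apply: eq_in_count => u; rewrite mem_iota => /aP.
rewrite -[RHS](size_iota 0) -(size_map f (iota 0 K)); apply/perm_size/uniq_perm.
- by rewrite filter_uniq ?iota_uniq.
- rewrite map_inj_in_uniq ?iota_uniq // => g g'; rewrite !mem_iota => gK gK' eq.
  by rewrite -(fD g) // eq fD.
move=> u; rewrite mem_filter mem_iota /=; apply/andP/mapP.
  by case=> /eqP fu uN; exists (u %/ D) => //; rewrite mem_iota /= ltn_divLR.
by case=> g; rewrite mem_iota => /= gK ->; rewrite fD // eqxx fN.
Qed.

(** * Forbidden pairs that express chains *)

Section Clauses.

Variables (m n b V1 : nat) (sc : nat -> nat -> nat -> nat) (win : nat -> bool).

(* A node stands for "after unit [l], which is the [e]-th one spent on voter [i],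
   issue [j] has score [v]", and is numbered
   [(((l * n + j) * m + i) * b.+1 + e) * V1 + v]. *)
Definition block : nat := m * b.+1 * V1.
Definition unit_of (u : nat) : nat := u %/ block %/ n.
Definition issue_of (u : nat) : nat := (u %/ block) %% n.
Definition choice_of (u : nat) : nat := (u %% block) %/ V1.
Definition total_of (u : nat) : nat := (u %% block) %% V1.
Definition pair_of (u : nat) : nat * nat :=
  (choice_of u %/ b.+1, choice_of u %% b.+1).

(** The first two disjuncts restrict [u] alone and hold for every partner, in particular for [u]
    itself: first unit, then last unit. The third makes each block a clique, the fourth makes all
    issues of a unit agree on voter and rank, and the fifth relates consecutive units on one
    issue. *)
Definition forbidden (u u' : nat) : bool :=
  [|| (unit_of u == 0) &&
        ~~ (((pair_of u).2 == 1) &&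
            gain_ok sc (issue_of u) (pair_of u)
              (score m sc (fun=> 0) (issue_of u)) (total_of u)),
      ((unit_of u).+1 == b) && ~~ win (total_of u),
      (u %/ block == u' %/ block) && (u != u'),
      (unit_of u == unit_of u') && (choice_of u != choice_of u') |
      [&& issue_of u == issue_of u', (unit_of u).+1 == unit_of u' &
        ~~ (step (pair_of u) (pair_of u') &&
            gain_ok sc (issue_of u) (pair_of u') (total_of u) (total_of u'))]].

Definition nodes : nat := b * n * block.

(** For [b = 0] there are no nodes; a lost issue then contributes the empty clause, which
    rejects. *)
Definition clauses : seq (seq nat) :=
  flatten [seq flatten [seq if forbidden u u' then [:: [:: u; u']] else [::]
                        | u' <- iota 0 nodes] | u <- iota 0 nodes] ++
  flatten [seq if (b == 0) && ~~ win (score m sc (fun=> 0) j) then [:: [::]] else [::]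
           | j <- iota 0 n].

Lemma clauses_clauses_ok : clauses_ok nodes clauses.
Proof.
rewrite /clauses_ok all_cat; apply/andP; split; apply/allP => c.
  case/flattenP => _ /mapP[u + ->] /flattenP[_ /mapP[u' + ->]].
  by rewrite !mem_iota => /= uN uN'; case: ifP => // _; rewrite inE => /eqP -> /=; rewrite uN uN'.
by case/flattenP => _ /mapP[j _ ->]; case: ifP => // _; rewrite inE => /eqP ->.
Qed.

Lemma all_clauses (P : pred (seq nat)) :
  all P clauses <->
  (forall u u', u < nodes -> u' < nodes -> forbidden u u' -> P [:: u; u']) /\
  (b = 0 -> forall j, j < n -> ~~ win (score m sc (fun=> 0) j) -> P [::]).
Proof.
rewrite /clauses all_cat; split=> [/andP[/allP H1 /allP H2]|[H1 H2]].
  split=> [u u' uN uN' f|/eqP b0 j jn nw].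
    apply: H1; apply/flattenP; eexists; first by apply/mapP; exists u; rewrite ?mem_iota.
    apply/flattenP; eexists; first by apply/mapP; exists u'; rewrite ?mem_iota.
    by rewrite f inE.
  apply: H2; apply/flattenP; eexists; first by apply/mapP; exists j; rewrite ?mem_iota.
  by rewrite b0 nw inE.
apply/andP; split; apply/allP => c.
  case/flattenP => _ /mapP[u + ->] /flattenP[_ /mapP[u' + ->]].
  by rewrite !mem_iota => /= uN uN'; case: ifP => // f; rewrite inE => /eqP ->; apply: H1.
case/flattenP => _ /mapP[j + ->]; rewrite mem_iota => /= jn.
by case: ifP => // /andP[/eqP b0 nw]; rewrite inE => /eqP ->; exact: (H2 b0 j).
Qed.

Hypothesis m_gt0 : 0 < m.
Hypothesis n_gt0 : 0 < n.
Hypothesis sc_mono : forall i j e e', e <= e' -> sc i j e <= sc i j e'.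
Hypothesis score_lt : forall E j, score m sc E j < V1.
Hypothesis win_up : forall x y, x <= y -> win x -> win y.

Let V1_gt0 : 0 < V1.
Proof. exact: leq_ltn_trans (score_lt (fun=> 0) 0). Qed.

Let block_gt0 : 0 < block.
Proof. by rewrite !muln_gt0 m_gt0 V1_gt0. Qed.

Definition node (l j i e v : nat) : nat :=
  (l * n + j) * block + ((i * b.+1 + e) * V1 + v).

Lemma decode l j i e v : j < n -> i < m -> e <= b -> v < V1 ->
  let u := node l j i e v in
  [/\ u %/ block = l * n + j, unit_of u = l, issue_of u = j,
      choice_of u = i * b.+1 + e & pair_of u = (i, e) /\ total_of u = v].
Proof.
move=> jn im eb vV u.
have cC : i * b.+1 + e < m * b.+1 by nia.
have wD : (i * b.+1 + e) * V1 + v < block by rewrite /block; nia.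
have q : u %/ block = l * n + j by rewrite divnMDl // divn_small ?addn0.
have r : u %% block = (i * b.+1 + e) * V1 + v by rewrite modnMDl modn_small.
have c : choice_of u = i * b.+1 + e.
  by rewrite /choice_of r divnMDl // divn_small ?addn0.
split=> //.
- by rewrite /unit_of q divnMDl // divn_small ?addn0.
- by rewrite /issue_of q modnMDl modn_small.
- split; last by rewrite /total_of r modnMDl modn_small.
  by rewrite /pair_of c divnMDl // divn_small ?ltnS // addn0 modnMDl modn_small.
Qed.

Lemma pair_of_lt u : (pair_of u).1 < m /\ (pair_of u).2 <= b.
Proof.
split; last by rewrite /= -ltnS ltn_mod.
rewrite /= ltn_divLR // ltn_divLR //; exact: ltn_pmod.
Qed.

(** The bound [v l j < V1] lets a total be stored as the last digit of a node number; in the other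
    direction it holds because totals are remainders modulo [V1]. *)
Lemma forbidden_chain :
  (exists f : nat -> nat, (forall g, g < b * n -> f g %/ block = g) /\
     forall g g', g < b * n -> g' < b * n -> ~~ forbidden (f g) (f g')) <->
  exists c v, [/\ chain m n b sc c v, forall l j, l < b -> j < n -> v l j < V1 &
     forall j, j < n -> 0 < b -> win (v b.-1 j)].
Proof.
split=> [[f [fD ff]]|[c [v [[c_le c_step c0 g0 g_step] vV w]]]].
  have gK l j : l < b -> j < n -> l * n + j < b * n by nia.
  have fu l j : l < b -> j < n -> unit_of (f (l * n + j)) = l.
    by move=> lb jn; rewrite /unit_of fD ?gK // divnMDl // divn_small ?addn0.
  have fi l j : l < b -> j < n -> issue_of (f (l * n + j)) = j.
    by move=> lb jn; rewrite /issue_of fD ?gK // modnMDl modn_small.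
  (* Voter and rank of a unit are read off at issue 0; the fourth disjunct of [forbidden] transfers
     them to the other issues. *)
  pose c l := pair_of (f (l * n + 0)).
  have fp l j : l < b -> j < n -> pair_of (f (l * n + j)) = c l.
    move=> lb jn; rewrite /c /pair_of.
    have := ff _ _ (gK _ _ lb jn) (gK _ _ lb n_gt0).
    rewrite /forbidden !fu // eqxx /= !negb_or negbK.
    by case/and5P => _ _ _ /eqP ->.
  exists c, (fun l j => total_of (f (l * n + j))); split.
  - split=> [l lb|l lb|b0|j jn b0|l j jn lb].
    + exact: pair_of_lt.
    + have := ff _ _ (gK _ _ (ltnW lb) n_gt0) (gK _ _ lb n_gt0).
      rewrite /forbidden !fu ?(ltnW lb) // !fi ?(ltnW lb) // !eqxx /= !negb_or.
      by case/and5P => _ _ _ _; rewrite !negbK => /andP[].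
    + have := ff _ _ (gK _ _ b0 n_gt0) (gK _ _ b0 n_gt0).
      rewrite /forbidden !fu // eqxx /= !negb_or !negbK.
      by case/and5P => /andP[/eqP].
    + have := ff _ _ (gK _ _ b0 jn) (gK _ _ b0 jn).
      rewrite /forbidden !fu // !fi // fp // eqxx /= !negb_or !negbK.
      by case/and5P => /andP[].
    + have := ff _ _ (gK _ _ (ltnW lb) jn) (gK _ _ lb jn).
      rewrite /forbidden !fu ?(ltnW lb) // !fi ?(ltnW lb) // !fp ?(ltnW lb) // !eqxx /= !negb_or.
      by case/and5P => _ _ _ _; rewrite !negbK => /andP[].
  - by move=> l j _ _; rewrite /total_of ltn_pmod.
  - move=> j jn b0; have lb : b.-1 < b by rewrite prednK.
    have := ff _ _ (gK _ _ lb jn) (gK _ _ lb jn).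
    rewrite /forbidden !fu // prednK // eqxx /= !negb_or !negbK.
    by case/and5P.
pose f g := let l := g %/ n in node l (g %% n) (c l).1 (c l).2 (v l (g %% n)).
have dec g : g < b * n -> let l := g %/ n in let j := g %% n in
    [/\ l < b /\ j < n, f g %/ block = g, unit_of (f g) = l, issue_of (f g) = j &
     [/\ choice_of (f g) = (c l).1 * b.+1 + (c l).2, pair_of (f g) = c l &
         total_of (f g) = v l j]].
  move=> gK l j; have lb : l < b by rewrite ltn_divLR.
  have jn : j < n by rewrite ltn_mod.
  have [cm cb] := c_le l lb.
  have [d1 d2 d3 d4 [d5 d6]] := decode l jn cm cb (vV l j lb jn).
  by split=> //; [rewrite d1 -divn_eq|split=> //; rewrite d5; case: (c l)].
exists f; split=> [g /dec[]//|g g' /dec[[lb jn] q1 q2 q3 [q4 q5 q6]]].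
move=> /dec[[lb' jn'] p1 p2 p3 [p4 p5 p6]].
rewrite /forbidden q1 q2 q3 q4 q5 q6 p1 p2 p3 p4 p5 p6.
rewrite !negb_or; apply/and5P; split.
- apply/negP => /andP[/eqP l0]; have b0 := leq_ltn_trans (leq0n _) lb.
  by rewrite l0 c0 // g0.
- apply/negP => /andP[/eqP l1]; have -> : g %/ n = b.-1 by rewrite -l1.
  by rewrite w //; exact: leq_ltn_trans lb.
- by apply/negP => /andP[/eqP -> ]; rewrite eqxx.
- by apply/negP => /andP[/eqP -> ]; rewrite eqxx.
- apply/negP => /and3P[/eqP <- /eqP l1]; rewrite -l1 in lb' *.
  by rewrite c_step // g_step.
Qed.

Theorem clause_circuit_correct :
  (exists E : nat -> nat, \sum_(i < m) E i <= b /\ forall j, j < n -> win (score m sc E j)) <->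
  exists a : nodes.-tuple bool, count id a = b * n /\
    circuit_value (C := clause_circuit nodes clauses) a.
Proof.
have same u u' : u %/ block = u' %/ block -> u != u' -> forbidden u u'.
  by move=> /eqP eq ne; rewrite /forbidden eq ne !orbT.
have [I1 I2] := indep_set (b * n) block_gt0 same.
have [F1 F2] := forbidden_chain.
split.
- move=> [E [Eb Ew]].
  have [w0 [c [v [cv vG w]]]] := chain_of_alloc m_gt0 sc_mono win_up Eb Ew.
  have [|a [aK af]] := I2 (F2 _).
    by exists c, v; split=> // l j _ _; have [G ->] := vG l j.
  exists a; split=> //; rewrite clause_circuit_value ?clauses_clauses_ok //.
  apply/all_clauses; split=> [u u' uN uN' f|b0 j jn]; last by rewrite w0.
  by rewrite /= andbT af.
- move=> [a [aK]]; rewrite clause_circuit_value ?clauses_clauses_ok // => /all_clauses[H1 H2].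
  have [|c [v [cv _ w]]] := F1 (I1 _).
    exists a; split=> // u u' uN uN' f.
    by have := H1 u u' uN uN' f; rewrite /= andbT.
  apply: (alloc_of_chain m_gt0 win_up _ cv w) => b0 j jn.
  by apply/negPn/negP => /(H2 b0 j jn).
Qed.

End Clauses.

(** * Scores in an encoded instance *)

Lemma nth_flatten_uniform (k : nat) (ss : seq word) a c :
  all (fun s => size s == k) ss -> c < k ->
  nth 0 (flatten ss) (a * k + c) = nth 0 (nth [::] ss a) c.
Proof.
elim: ss a => [|s ss IH] a /=; first by rewrite !nth_nil.
case/andP=> /eqP sk ssk ck; rewrite nth_cat sk.
case: a => [|a]; first by rewrite mul0n add0n ck.
by rewrite mulSn -addnA ltnNge leq_addr /= addKn IH.
Qed.

Lemma nth_allpairs_uniform T (m n : nat) (f : 'I_m -> 'I_n -> T) x0 (i : 'I_m) (j : 'I_n) :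
  nth x0 [seq f i j | i <- enum 'I_m, j <- enum 'I_n] (i * n + j) = f i j.
Proof.
suff H (s : seq 'I_m) (a : nat) : a < size s ->
    nth x0 [seq f i j | i <- s, j <- enum 'I_n] (a * n + j) = f (nth i s a) j.
  by rewrite H ?size_enum_ord // nth_ord_enum.
elim: s a => [|i' s IH] a //= Ha; rewrite nth_cat size_map size_enum_ord.
case: a Ha => [|a] /= Ha.
  by rewrite mul0n add0n ltn_ord (nth_map j) ?size_enum_ord // nth_ord_enum.
by rewrite mulSn -addnA ltnNge leq_addr /= addKn IH.
Qed.

Section Data.

Variable w : word.

Let m := nth 0 w 0.
Let n := nth 0 w 1.
Let k1 := (nth 0 w 2).+1.

(** Six numbers precede the probabilities: four dimensions and the two parts of the threshold. Each
    probability again takes two. *)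
Definition cost_at (i j s : nat) : nat :=
  nth 0 w (6 + (m * n).*2 + ((i * n + j) * k1.+1 + s)).

Definition target_at (j : nat) : nat :=
  nth 0 w (6 + (m * n).*2 + (m * n * k1.+1 + j)).

(* If voter [i] receives [n * e], then the probability of voting [Z_j] on issue [j]
   becomes [points i j e / (level + 1)]: the number of admissible values below the
   greatest, resp. from the least affordable one on. *)
Definition points (i j e : nat) : nat :=
  \sum_(s < k1) (0 < \sum_(s' < k1.+1)
     ((cost_at i j s' <= e) && (if target_at j != 0 then s < s' else s' <= s))).

(** The test [t < v / (m * k1)] with denominators cleared; entries 4 and 5 are the numerator and
    denominator of the threshold. *)
Definition enough (v : nat) : bool := nth 0 w 4 * (m * k1) < nth 0 w 5 * v.

Lemma points_mono i j e e' : e <= e' -> points i j e <= points i j e'.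
Proof.
move=> le; apply: leq_sum => s _.
have : \sum_(s' < k1.+1) ((cost_at i j s' <= e) && (if target_at j != 0 then s < s' else s' <= s))
  <= \sum_(s' < k1.+1) ((cost_at i j s' <= e') && (if target_at j != 0 then s < s' else s' <= s)).
  apply: leq_sum => s' _; case: (leqP (cost_at i j s') e) => // H.
  by rewrite (leq_trans H le).
by lia.
Qed.

Lemma points_le i j e : points i j e <= k1.
Proof.
rewrite -[leqRHS]mul1n mulnC -[X in X * 1]card_ord -sum_nat_const leq_sum // => s _.
exact: leq_b1.
Qed.

Lemma score_points_lt E j : score m points E j < (m * k1).+1.
Proof.
rewrite ltnS -[X in X * _]card_ord -sum_nat_const leq_sum // => i _; exact: points_le.
Qed.

Lemma enough_up x y : x <= y -> enough x -> enough y.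
Proof. by move=> le; rewrite /enough => /leq_trans; apply; rewrite leq_mul2l le orbT. Qed.

End Data.

Lemma sum_bool_gt0 N (P : pred nat) :
  (0 < \sum_(s < N) P s) = [exists s : 'I_N, P s].
Proof.
apply/idP/existsP => [|[s Ps]]; last by rewrite (bigD1 s) //= Ps.
rewrite lt0n => H; apply/existsP; apply: contraR H => /existsPn H.
by rewrite big1 // => s _; rewrite (negbTE (H s)).
Qed.

Lemma sum_below N q : q <= N -> \sum_(s < N) (s < q) = q.
Proof.
move=> qN; have [k ->] : exists k, N = q + k by exists (N - q); rewrite subnKC.
rewrite big_split_ord /= [X in _ + X]big1 => [|i _].
  by rewrite addn0 (eq_bigr (fun=> 1)) ?sum1_card ?card_ord // => i _; rewrite ltn_ord.
by rewrite ltnNge leq_addr.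
Qed.

Lemma sum_from N q : q <= N -> \sum_(s < N) (q <= s) = N - q.
Proof.
move=> qN; have [k ->] : exists k, N = q + k by exists (N - q); rewrite subnKC.
rewrite addKn big_split_ord /= big1 => [|i _].
  by rewrite add0n (eq_bigr (fun=> 1)) ?sum1_card ?card_ord // => i _; rewrite leq_addr.
by rewrite leqNgt ltn_ord.
Qed.

(** * Bribed probabilities counted in points *)

Section Instance.

Import Order.TTheory GRing.Theory Num.Theory.

Variable x : vbam_instance.
Let w := vbam_encode x.
Let m := nvoters x.
Let n := nissues x.
Let k1 := (level x).+1.

Lemma size_allpairs_enum T (f : 'I_m -> 'I_n -> T) :
  size [seq f i j | i <- enum 'I_m, j <- enum 'I_n] = m * n.
Proof. by rewrite size_allpairs !size_enum_ord. Qed.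

Lemma all_allpairs_enum (T : eqType) (f : 'I_m -> 'I_n -> T) (P : pred T) :
  (forall i j, P (f i j)) -> all P [seq f i j | i <- enum 'I_m, j <- enum 'I_n].
Proof. by move=> H; apply/allP => t /allpairsP[[i j] [_ _ ->]]. Qed.

Lemma size_flatten_uniform (k : nat) (ss : seq word) :
  all (fun s => size s == k) ss -> size (flatten ss) = size ss * k.
Proof.
by elim: ss => //= s ss IH /andP[/eqP sk /IH]; rewrite size_cat sk mulSn => ->.
Qed.

Let probs := flatten [seq encode_rat (prob x i j) | i <- enum 'I_m, j <- enum 'I_n].
Let costs := flatten [seq [seq cost i j s | s <- enum 'I_(level x).+2]
                        | i <- enum 'I_m, j <- enum 'I_n].
Let targets := [seq nat_of_bool (target j) | j <- enum 'I_n].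

Let size_probs : size probs = (m * n).*2.
Proof.
by rewrite (@size_flatten_uniform 2) ?size_allpairs_enum ?muln2 // all_allpairs_enum.
Qed.

Let costs_uniform : all (fun s => size s == k1.+1)
  [seq [seq cost i j s | s <- enum 'I_(level x).+2] | i <- enum 'I_m, j <- enum 'I_n].
Proof. by apply: all_allpairs_enum => i j; rewrite size_map size_enum_ord. Qed.

Let size_costs : size costs = m * n * k1.+1.
Proof. by rewrite (size_flatten_uniform costs_uniform) size_allpairs_enum. Qed.

Let wE : w = [:: m, n, level x, budget x, `|numq (threshold x)|%N, `|denq (threshold x)|%N
                & probs ++ costs ++ targets].
Proof. by []. Qed.

Let nth_w k : nth 0 w (6 + k) = nth 0 (probs ++ costs ++ targets) k.
Proof. by []. Qed.

Let dims : (nth 0 w 0 = m) * (nth 0 w 1 = n) * ((nth 0 w 2).+1 = k1).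
Proof. by []. Qed.

Lemma size_vbam_encode : size w = 6 + (m * n).*2 + m * n * k1.+1 + n.
Proof. by rewrite wE /= !size_cat size_probs size_costs size_map size_enum_ord; lia. Qed.

Lemma cost_atE (i : 'I_m) (j : 'I_n) (s : 'I_(level x).+2) : cost_at w i j s = cost i j s.
Proof.
rewrite /cost_at -addnA nth_w !dims nth_cat size_probs ltnNge leq_addr /= addKn.
have lt : (i * n + j) * k1.+1 + s < m * n * k1.+1.
  have h : i * n + j < m * n by have := ltn_ord i; have := ltn_ord j; rewrite -/m -/n; nia.
  apply: (@leq_trans ((i * n + j).+1 * k1.+1)); last by rewrite leq_mul2r h orbT.
  by rewrite mulSn addnC ltn_add2r ltn_ord.
rewrite nth_cat size_costs lt (nth_flatten_uniform _ costs_uniform) ?ltn_ord //.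
by rewrite nth_allpairs_uniform (nth_map s) ?size_enum_ord // nth_ord_enum.
Qed.

Lemma target_atE (j : 'I_n) : (target_at w j != 0) = target j.
Proof.
rewrite /target_at -addnA nth_w !dims nth_cat size_probs ltnNge leq_addr /= addKn.
rewrite nth_cat size_costs ltnNge leq_addr /= addKn (nth_map j) ?size_enum_ord //.
by rewrite nth_ord_enum; case: target.
Qed.


Local Open Scope ring_scope.

Let k1_gt0 : 0 < k1%:R :> rat.
Proof. by rewrite ltr0n. Qed.

Lemma le_admissible (s s' : 'I_(level x).+2) :
  (admissible s <= admissible s') = (s <= s')%N.
Proof. by rewrite /admissible ler_pM2r ?invr_gt0 // ler_nat. Qed.

(** The denominator of the probability divides [level + 1], so multiplying by [level + 1] gives an
    integer between 0 and [level + 1]. *)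
Lemma prob_admissible i j : exists s : 'I_(level x).+2, admissible s = prob x i j.
Proof.
have /dvdzP[c Hc] := prob_level i j; have /andP[p0 p1] := prob_01 i j.
set p := prob x i j in Hc p0 p1 *.
have pk : p * k1%:R = (numq p * c)%:~R.
  by rewrite -[k1%:R]/(k1%:Z%:~R) Hc !intrM numqE mulrCA mulrC mulrAC.
have c0 : 0 <= numq p * c by rewrite -(@ler0z rat) -pk mulr_ge0 // ler0n.
set z := numq p * c in pk c0.
have ak : `|z|%N%:R = p * k1%:R by rewrite pk natr_absz ger0_norm.
have lt : (`|z| < k1.+1)%N.
  by rewrite ltnS -(ler_nat rat) ak -[leRHS]mul1r ler_wpM2r ?ler0n.
exists (Ordinal lt); rewrite /admissible /= ak mulfK //; exact: lt0r_neq0.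
Qed.

(** [points] looks for the extreme affordable value without comparing it with the initial
    probability. This gives the same result: the initial probability is admissible and free, so the
    greatest affordable value is never below it and the least never above it. *)
Lemma bribed_prob_points (d : 'I_m -> rat) (e : nat) (i : 'I_m) (j : 'I_n) :
  (forall c : nat, (c%:R <= d i / n%:R) = (c <= e)%N) ->
  (if target j then bribed_prob d i j else 1 - bribed_prob d i j) = (points w i j e)%:R / k1%:R.
Proof.
move=> dP; have [s0 s0P] := prob_admissible i j.
have c0 : (cost i j s0 <= e)%N by rewrite (cost_prob s0P).
have pointsE : points w i j e = (\sum_(s < k1) [exists s' : 'I_(level x).+2,
    (cost i j s' <= e) && (if target j then s < s' else s' <= s)])%N.
  rewrite /points target_atE; apply: eq_bigr => s _; congr nat_of_bool.
  rewrite (sum_bool_gt0 _ (fun s' => (cost_at w i j s' <= e) &&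
    (if target j then s < s' else s' <= s)))%N.
  by apply: eq_existsb => s'; rewrite cost_atE.
rewrite pointsE /bribed_prob -s0P.
case: (target j).
- have [q qe qmax'] := @arg_maxnP _ s0 (fun s => cost i j s <= e)%N (@nat_of_ord _) c0.
  have qmax s : (cost i j s <= e)%N -> (s <= q)%N := qmax' s.
  have -> : \big[Num.max/admissible s0]_(s < (level x).+2 |
      (admissible s0 <= admissible s) && ((cost i j s)%:R <= d i / n%:R))
        admissible s = admissible q.
    apply/le_anti/andP; split.
      apply/bigmax_leP; split=> [|s]; first by rewrite le_admissible qmax.
      by rewrite dP le_admissible => /andP[_ /qmax]; rewrite le_admissible.
    by apply: le_bigmax_cond; rewrite dP qe le_admissible qmax.
  congr (_%:R / _); rewrite -[LHS](@sum_below k1) -1?ltnS ?ltn_ord //.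
  apply: eq_bigr => s _; congr (nat_of_bool _); apply/idP/existsP => [sq|[s' /andP[/qmax]]].
    by exists q; rewrite qe.
  by move=> s'q ss'; exact: leq_trans ss' s'q.
- have [q qe qmin] := @arg_minnP _ s0 (fun s => cost i j s <= e)%N (@nat_of_ord _) c0.
  have -> : \big[Num.min/admissible s0]_(s < (level x).+2 |
      (admissible s <= admissible s0) && ((cost i j s)%:R <= d i / n%:R))
        admissible s = admissible q.
    apply/le_anti/andP; split.
      by apply: bigmin_le_cond; rewrite dP qe le_admissible qmin.
    apply/bigmin_geP; split=> [|s]; first by rewrite le_admissible qmin.
    by rewrite dP le_admissible => /andP[_ /qmin]; rewrite le_admissible.
  have qk : (q <= k1)%N by rewrite -ltnS.
  (* [1 - q / k1] is [(k1 - q) / k1], and [k1 - q] counts the values from [q] on. *)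
  rewrite /admissible -[X in X - _](@mulfV _ k1%:R) ?lt0r_neq0 // -mulrBl -natrB //.
  congr (_%:R / _); rewrite -(sum_from qk).
  apply: eq_bigr => s _; congr (nat_of_bool _); apply/idP/existsP => [sq|[s' /andP[/qmin]]].
    by exists q; rewrite qe.
  by move=> qs' s's; exact: leq_trans qs' s's.
Qed.

Lemma won_points (d : 'I_m -> rat) (E : nat -> nat) (j : 'I_n) :
  (forall (i : 'I_m) (c : nat), (c%:R <= d i / n%:R) = (c <= E i)%N) ->
  won_AM (bribed_prob d) j <-> enough w (score m (points w) E j).
Proof.
move=> dP; rewrite /won_AM.
rewrite (eq_bigr (fun i : 'I_m => (points w i j (E i))%:R / k1%:R)); last first.
  by move=> i _; apply: bribed_prob_points.
rewrite -mulr_suml -natr_sum /enough !dims /=.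
set S := (\sum_(i < m) _)%N; have -> : score m (points w) E j = S by [].
have /andP[t0 _] := threshold_01 x; set t := threshold x in t0 *.
have m0 : 0 < m%:R :> rat by rewrite ltr0n nvoters_gt0.
have d0 : 0 < (denq t)%:~R :> rat by rewrite ltr0z denq_gt0.
have tE : t * (denq t)%:~R = (numq t)%:~R by rewrite numqE.
have nN : (numq t)%:~R = `|numq t|%N%:R :> rat.
  by rewrite natr_absz ger0_norm // numq_ge0.
have dN : (denq t)%:~R = `|denq t|%N%:R :> rat.
  by rewrite natr_absz ger0_norm // denq_ge0.
rewrite ltr_pdivlMr // ltr_pdivlMr // -(ltr_pM2r d0) -(ltr_nat rat) !natrM -dN -nN -tE.
have -> : t * m%:R * k1%:R * (denq t)%:~R = t * (denq t)%:~R * (m%:R * k1%:R) by ring.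
by rewrite [S%:R * _]mulrC.
Qed.

(** Prices are integers, so [d i / n] may be replaced by its integer part [E i]; then [n] times the
    sum of the [E i] is an integer at most the budget. Conversely, voter [i] is paid [E i * n]. *)
Lemma vbam_yesP :
  vbam_yes x <-> exists E : nat -> nat, (\sum_(i < m) E i <= budget x %/ n)%N /\
    forall j, (j < n)%N -> enough w (score m (points w) E j).
Proof.
have n0 : 0 < n%:R :> rat by rewrite ltr0n nissues_gt0.
split=> [[d [d0 dB dw]]|[E [EB Ew]]].
- pose E i := if insub i is Some i' then Num.trunc (d i' / n%:R) else 0%N.
  have EP (i : 'I_m) (c : nat) : (c%:R <= d i / n%:R) = (c <= E i)%N.
    by rewrite /E valK truncn_ge_nat // divr_ge0 // ltW.
  exists E; split.
    rewrite leq_divRL ?nissues_gt0 // -(ler_nat rat); apply: le_trans dB.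
    rewrite natrM natr_sum mulr_suml; apply: ler_sum => i _.
    by rewrite -ler_pdivlMr // EP.
  by move=> j jn; apply/(won_points (Ordinal jn) EP).
- exists (fun i => (E i * n)%:R); split=> [i| |j].
  + exact: ler0n.
  + by rewrite -natr_sum ler_nat -big_distrl /= -leq_divRL // nissues_gt0.
  + apply/(@won_points _ E) => [i c|]; last exact: Ew.
    by rewrite natrM mulfK ?lt0r_neq0 // ler_nat.
Qed.

End Instance.

(** * The reduction as a program *)

(** Free variables are tracked because the macros below bind fixed variables around their arguments,
    where capture has to be excluded. *)
Fixpoint vars_in (P : pred nat) (e : expr) : bool :=
  match e with
  | Const _ => true
  | Var x => P x
  | Entry a => vars_in P a
  | Add a b | Sub a b => vars_in P a && vars_in P b
  | Sum x y a => P y && vars_in (fun z => (z == x) || P z) a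
  end.

Lemma eval_vars w (P : pred nat) e env env' :
  (forall x, P x -> env x = env' x) -> vars_in P e -> eval w env e = eval w env' e.
Proof.
elim: e P env env' => [n|x|a IHa|a IHa b IHb|a IHa b IHb|x y a IHa] P env env' H //=.
- exact: H.
- by move=> /(IHa _ _ _ H) ->.
- by move=> /andP[/(IHa _ _ _ H) -> /(IHb _ _ _ H) ->].
- by move=> /andP[/(IHa _ _ _ H) -> /(IHb _ _ _ H) ->].
- move=> /andP[/H -> Pa]; apply: eq_bigr => v _; apply: IHa Pa => z.
  by rewrite /upd; case: eqP => //= _ /H.
Qed.

(* Bound variables used by the expressions below: 23 and 24 range over admissible
   values, 25 over voters, 26 over quotients, 27 over scores; 30 is a dummy. *)
Definition reserved (x : nat) : bool := x \in [:: 23; 24; 25; 26; 27; 30].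

Definition closed (e : expr) : bool := vars_in (fun x => ~~ reserved x) e.

Lemma vars_in_sub (P Q : pred nat) e :
  (forall x, P x -> Q x) -> vars_in P e -> vars_in Q e.
Proof.
elim: e P Q => [n|x|a IHa|a IHa b IHb|a IHa b IHb|x y a IHa] P Q H //=.
- exact: H.
- exact: IHa.
- by move=> /andP[/(IHa _ _ H) -> /(IHb _ _ H) ->].
- by move=> /andP[/(IHa _ _ H) -> /(IHb _ _ H) ->].
- by move=> /andP[/H -> /=]; apply: IHa => z /orP[->//|/H ->]; rewrite orbT.
Qed.

Definition fresh (z : nat) (e : expr) : bool := vars_in (predC1 z) e.

Lemma eval_fresh w env z v e : fresh z e -> eval w (upd env z v) e = eval w env e.
Proof.
by apply: eval_vars => x /= /negbTE; rewrite /upd => ->.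
Qed.

Lemma closed_fresh z e : reserved z -> closed e -> fresh z e.
Proof.
by move=> rz; apply: vars_in_sub => x; apply: contraNneq => ->.
Qed.

Definition Not (a : expr) := Sub (Const 1) a.
Definition Pos (a : expr) := Not (Not a).
Definition Le (a b : expr) := Not (Sub a b).
Definition Lt (a b : expr) := Le (Add a (Const 1)) b.
Definition Eq (a b : expr) := Not (Add (Sub a b) (Sub b a)).
Definition And (a b : expr) := Not (Add (Not a) (Not b)).
Definition Or (a b : expr) := Pos (Add a b).
Definition Mul (x : nat) (a : expr) := Sum 30 x a.
(** The quotient is the number of [q] with [y * (q + 1) <= a]. The variable [z] bounds the search
    and may be any one whose value is at least [a]. *)
Definition Div (z y : nat) (a : expr) :=
  Sum 26 z (Le (Mul y (Add (Var 26) (Const 1))) a).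
Definition Mod (z y : nat) (a : expr) := Sub a (Mul y (Div z y a)).

Lemma eval_Not w env a : eval w env (Not a) = (eval w env a == 0).
Proof. by rewrite /=; case: (eval w env a) => [|[]]. Qed.

Lemma eval_Pos w env a : eval w env (Pos a) = (0 < eval w env a).
Proof. by rewrite !eval_Not; case: (eval w env a). Qed.

Lemma eval_Le w env a b : eval w env (Le a b) = (eval w env a <= eval w env b).
Proof. by rewrite eval_Not. Qed.

Lemma eval_Lt w env a b : eval w env (Lt a b) = (eval w env a < eval w env b).
Proof. by rewrite eval_Le /= addn1. Qed.

Lemma eval_Eq w env a b : eval w env (Eq a b) = (eval w env a == eval w env b).
Proof. by rewrite eval_Not /= addn_eq0 !subn_eq0 eqn_leq. Qed.

Lemma eval_And w env a b (p q : bool) :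
  eval w env a = p -> eval w env b = q -> eval w env (And a b) = p && q.
Proof. by rewrite eval_Not /= => -> ->; case: p q => -[]. Qed.

Lemma eval_Or w env a b (p q : bool) :
  eval w env a = p -> eval w env b = q -> eval w env (Or a b) = p || q.
Proof. by rewrite eval_Pos /= => -> ->; case: p q => -[]. Qed.

Lemma eval_not w env a (p : bool) : eval w env a = p -> eval w env (Not a) = ~~ p.
Proof. by rewrite eval_Not => ->; case: p. Qed.

Lemma eval_Sum w env x y a :
  eval w env (Sum x y a) = \sum_(v < env y) eval w (upd env x v) a.
Proof. by []. Qed.

Lemma eval_Mul w env x a : fresh 30 a -> eval w env (Mul x a) = env x * eval w env a.
Proof.
move=> fa; rewrite /= (eq_bigr (fun=> eval w env a)) ?sum_nat_const ?card_ord // => v _.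
by rewrite eval_fresh.
Qed.

Lemma eval_Div w env z y a : closed a -> y != 26 -> 0 < env y -> eval w env a <= env z ->
  eval w env (Div z y a) = eval w env a %/ env y.
Proof.
move=> ca y26 y0 az; rewrite -[RHS](@sum_below (env z)); last first.
  by apply: leq_trans az; exact: leq_div.
rewrite eval_Sum; apply: eq_bigr => q _; rewrite eval_Le eval_Mul //.
rewrite (@eval_fresh _ _ _ _ a) ?closed_fresh //=.
by rewrite /upd (negbTE y26) leq_divRL // mulnC addn1.
Qed.

Lemma eval_Mod w env z y a :
  closed a -> ~~ reserved z -> ~~ reserved y -> 0 < env y -> eval w env a <= env z ->
  eval w env (Mod z y a) = eval w env a %% env y.
Proof.
move=> ca rz ry y0 az; have y26 : y != 26 by apply: contraNneq ry => ->.
have -> : eval w env (Mod z y a) = eval w env a - eval w env (Mul y (Div z y a)) by [].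
rewrite eval_Mul ?eval_Div //.
  by rewrite {1}(divn_eq (eval w env a) (env y)) mulnC addKn.
have n30 x : ~~ reserved x -> x != 30 by apply: contraNneq => ->.
rewrite /fresh /= !n30 //=.
rewrite orbT /=; apply: (@vars_in_sub (predC1 30)); last exact: closed_fresh.
by move=> x /= ->; rewrite !orbT.
Qed.

Lemma vars_in_all (P : pred nat) e : (forall x, P x) -> vars_in P e.
Proof.
move=> H; elim: e P H => [n|x|a IHa|a IHa b IHb|a IHa b IHb|x y a IHa] P H //=.
- exact: IHa.
- by rewrite IHa ?IHb.
- by rewrite IHa ?IHb.
- by rewrite H IHa // => z; rewrite H orbT.
Qed.

Lemma fresh_Mul x a : x != 30 -> fresh 30 (Mul x a).
Proof. by move=> x30; rewrite /fresh /= x30 vars_in_all // => z; case: eqP. Qed.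

Lemma closed_Mul x a : ~~ reserved x -> closed a -> closed (Mul x a).
Proof.
by move=> rx ca; rewrite /closed /= rx; apply: vars_in_sub ca => z ->; rewrite orbT.
Qed.

Lemma closed_Div z y a : ~~ reserved z -> ~~ reserved y -> closed a -> closed (Div z y a).
Proof.
move=> rz ry ca; rewrite /closed /= rz ry !orbT /=.
by apply: vars_in_sub ca => x ->; rewrite orbT.
Qed.

Lemma closed_Mod z y a : ~~ reserved z -> ~~ reserved y -> closed a -> closed (Mod z y a).
Proof.
move=> rz ry ca; have cM := closed_Mul ry (closed_Div rz ry ca).
by apply/andP; split.
Qed.

(* Registers: 1, 2 the numbers [m], [n] of voters and issues, 3 and 4 [level + 1]
   and [level + 2], 5 the budget, 6 [b = budget / n], 7 [b + 1], 8 the number of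
   scores, 9 [b * n], 10 [block], 11 [nodes], 12 the number of clauses. *)
Definition cost_expr (i j s : expr) : expr :=
  Entry (Add (Add (Const 6) (Add (Mul 1 (Var 2)) (Mul 1 (Var 2))))
            (Add (Mul 4 (Add (Mul 2 i) j)) s)).

Definition target_expr (j : expr) : expr :=
  Pos (Entry (Add (Add (Const 6) (Add (Mul 1 (Var 2)) (Mul 1 (Var 2))))
                 (Add (Mul 4 (Mul 1 (Var 2))) j))).

Definition points_expr (i j e : expr) : expr :=
  Sum 23 3 (Pos (Sum 24 4
    (And (Le (cost_expr i j (Var 24)) e)
         (Or (And (target_expr j) (Lt (Var 23) (Var 24)))
             (And (Not (target_expr j)) (Le (Var 24) (Var 23))))))).

Definition base_expr (j : expr) : expr := Sum 25 1 (points_expr (Var 25) j (Const 0)).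

(** [Mul] wants a variable as its first factor; summing over all scores binds the value of [v] to
    variable 27. *)
Definition enough_expr (v : expr) : expr :=
  Pos (Sum 27 8 (And (Eq (Var 27) v)
    (Lt (Mul 1 (Mul 3 (Entry (Const 4)))) (Mul 27 (Entry (Const 5)))))).

Definition slot_expr (x : nat) := Div 11 10 (Var x).
Definition unit_expr (x : nat) := Div 11 2 (slot_expr x).
Definition issue_expr (x : nat) := Mod 11 2 (slot_expr x).
Definition choice_expr (x : nat) := Div 11 8 (Mod 11 10 (Var x)).
Definition total_expr (x : nat) := Mod 11 8 (Mod 11 10 (Var x)).
Definition voter_expr (x : nat) := Div 11 7 (choice_expr x).
Definition rank_expr (x : nat) := Mod 11 7 (choice_expr x).

Definition gain_expr (j i e x y : expr) : expr :=
  Le (Add y (points_expr i j (Sub e (Const 1)))) (Add x (points_expr i j e)).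

Definition forbidden_expr (x y : nat) : expr :=
  Or (And (Eq (unit_expr x) (Const 0))
          (Not (And (Eq (rank_expr x) (Const 1))
                    (gain_expr (issue_expr x) (voter_expr x) (rank_expr x)
                       (base_expr (issue_expr x)) (total_expr x)))))
  (Or (And (Eq (Add (unit_expr x) (Const 1)) (Var 6))
           (Not (enough_expr (total_expr x))))
  (Or (And (Eq (slot_expr x) (slot_expr y)) (Not (Eq (Var x) (Var y))))
  (Or (And (Eq (unit_expr x) (unit_expr y)) (Not (Eq (choice_expr x) (choice_expr y))))
      (And (Eq (issue_expr x) (issue_expr y))
      (And (Eq (Add (unit_expr x) (Const 1)) (unit_expr y))
           (Not (And (Or (And (Eq (voter_expr y) (voter_expr x))
                              (Eq (rank_expr y) (Add (rank_expr x) (Const 1))))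
                         (And (Lt (voter_expr x) (voter_expr y))
                              (Eq (rank_expr y) (Const 1))))
                     (gain_expr (issue_expr x) (voter_expr y) (rank_expr y)
                        (total_expr x) (total_expr y))))))))).

Definition lost_expr (j : nat) : expr :=
  And (Eq (Var 6) (Const 0)) (Not (enough_expr (base_expr (Var j)))).

(** * Values of the expressions for nodes and forbidden pairs *)

Section Globals.

Variable w : word.
Let m := nth 0 w 0.
Let n := nth 0 w 1.
Let k1 := (nth 0 w 2).+1.
Let b := nth 0 w 3 %/ n.
Let V1 := (m * k1).+1.

Record globals (env : nat -> nat) : Prop := Globals {
  global1 : env 1 = m;
  global2 : env 2 = n;
  global3 : env 3 = k1;
  global4 : env 4 = k1.+1;
  global6 : env 6 = b;
  global7 : env 7 = b.+1;
  global8 : env 8 = V1;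
  global10 : env 10 = block m b V1;
  global11 : env 11 = nodes m n b V1 }.

Lemma globals_upd env z v : 12 <= z -> globals env -> globals (upd env z v).
Proof.
by move=> z12 [g1 g2 g3 g4 g6 g7 g8 g10 g11]; split; rewrite /upd ifF //; apply/eqP; lia.
Qed.

Lemma eval_cost env i j s : globals env -> fresh 30 i -> fresh 30 j ->
  eval w env (cost_expr i j s) = cost_at w (eval w env i) (eval w env j) (eval w env s).
Proof.
move=> [g1 g2 g3 g4 _ _ _ _ _] fi fj.
have E a : eval w env (Entry a) = nth 0 w (eval w env a) by [].
have ED a c : eval w env (Add a c) = eval w env a + eval w env c by [].
rewrite /cost_expr E !ED !eval_Mul ?fi //; last first.
  by apply/andP; split=> //; exact: fresh_Mul.
rewrite !ED eval_Mul // /= g1 g2 g4 /cost_at addnn -/m -/n -/k1.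
by rewrite [k1.+1 * _]mulnC [n * _]mulnC.
Qed.

Lemma eval_target env j : globals env ->
  eval w env (target_expr j) = (target_at w (eval w env j) != 0).
Proof.
move=> [g1 g2 g3 g4 _ _ _ _ _].
have E a : eval w env (Entry a) = nth 0 w (eval w env a) by [].
have ED a c : eval w env (Add a c) = eval w env a + eval w env c by [].
rewrite /target_expr eval_Pos E !ED !eval_Mul //= g1 g2 g4.
by rewrite /target_at addnn -/m -/n -/k1 -lt0n [k1.+1 * _]mulnC.
Qed.

Lemma eval_points env i j e : globals env ->
  all (fun z => fresh z i && fresh z j && fresh z e) [:: 23; 24; 30] ->
  eval w env (points_expr i j e) = points w (eval w env i) (eval w env j) (eval w env e).
Proof.
move=> g /and4P[/andP[/andP[i3 j3] e3] /andP[/andP[i4 j4] e4] /andP[/andP[i0 j0] _] _].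
rewrite /points_expr eval_Sum (global3 g); apply: eq_bigr => s _.
set env1 := upd env 23 s; have g1 : globals env1 by exact: globals_upd.
rewrite eval_Pos eval_Sum (global4 g1); congr (nat_of_bool (0 < _)); apply: eq_bigr => s' _.
set env2 := upd env1 24 s'; have g2 : globals env2 by exact: globals_upd.
have ev a : fresh 23 a -> fresh 24 a -> eval w env2 a = eval w env a.
  by move=> f3 f4; rewrite /env2 eval_fresh // /env1 eval_fresh.
have Et := eval_target j g2; rewrite (ev j) // in Et.
have -> : (if target_at w (eval w env j) != 0 then s < s' else s' <= s) =
  (target_at w (eval w env j) != 0) && (s < s') ||
  ~~ (target_at w (eval w env j) != 0) && (s' <= s).
  by case: ifP => _ /=; rewrite ?orbF.
apply: eval_And; first by rewrite eval_Le eval_cost // (ev i) // (ev j) // (ev e).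
apply: eval_Or; first by apply: eval_And => //; rewrite eval_Lt.
by apply: eval_And; [apply: eval_not|rewrite eval_Le].
Qed.

Lemma eval_base env j : globals env ->
  all (fun z => fresh z j) [:: 23; 24; 25; 30] ->
  eval w env (base_expr j) = score m (points w) (fun=> 0) (eval w env j).
Proof.
move=> g /and5P[j3 j4 j5 j0 _].
rewrite /base_expr eval_Sum (global1 g); apply: eq_bigr => i _.
rewrite eval_points; last by rewrite /= j3 j4 j0.
  by rewrite (eval_fresh _ _ _ j5).
exact: globals_upd.
Qed.

Lemma eval_enough env v : globals env -> fresh 27 v -> eval w env v < V1 ->
  eval w env (enough_expr v) = enough w (eval w env v).
Proof.
move=> g fv vV; rewrite eval_Pos eval_Sum (global8 g).
have E (q : 'I_V1) : eval w (upd env 27 q) (And (Eq (Var 27) v)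
    (Lt (Mul 1 (Mul 3 (Entry (Const 4)))) (Mul 27 (Entry (Const 5))))) =
    ((q : nat) == eval w env v) && enough w q.
  have g' : globals (upd env 27 q) by exact: globals_upd.
  apply: eval_And; first by rewrite eval_Eq (eval_fresh _ _ _ fv).
  rewrite eval_Lt !eval_Mul ?fresh_Mul // (global1 g') (global3 g') /=.
  by rewrite /enough mulnA [_ * nth 0 w 4]mulnC [q * _]mulnC.
rewrite (eq_bigr _ (fun q _ => E q)) (sum_bool_gt0 V1 (fun q => (q == eval w env v) && enough w q)).
congr nat_of_bool; apply/existsP/idP => [[q /andP[/eqP <-]]//|ev].
by exists (Ordinal vV); rewrite /= eqxx.
Qed.

Hypothesis m_gt0 : 0 < m.
Hypothesis n_gt0 : 0 < n.

Let block_gt0 : 0 < block m b V1.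
Proof. by rewrite /block !muln_gt0 m_gt0. Qed.

Section Node.

Variables (env : nat -> nat) (x : nat).
Hypothesis g : globals env.
Hypothesis rx : ~~ reserved x.
Hypothesis xN : env x < nodes m n b V1.

Lemma eval_slot : eval w env (slot_expr x) = env x %/ block m b V1.
Proof. by rewrite eval_Div //= ?(global10 g) // (global11 g) ltnW. Qed.

Let slot_closed : closed (slot_expr x). Proof. exact: closed_Div. Qed.

Let slot_le : eval w env (slot_expr x) <= env 11.
Proof. by rewrite eval_slot (global11 g); apply: leq_trans (leq_div _ _) (ltnW xN). Qed.

Lemma eval_unit : eval w env (unit_expr x) = unit_of m n b V1 (env x).
Proof. by rewrite eval_Div // ?(global2 g) // eval_slot. Qed.

Lemma eval_issue : eval w env (issue_expr x) = issue_of m n b V1 (env x).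
Proof. by rewrite eval_Mod // ?(global2 g) // eval_slot. Qed.

Let rest_closed : closed (Mod 11 10 (Var x)). Proof. exact: closed_Mod. Qed.

Let eval_rest : eval w env (Mod 11 10 (Var x)) = env x %% block m b V1.
Proof. by rewrite eval_Mod //= ?(global10 g) // (global11 g) ltnW. Qed.

Let rest_le : eval w env (Mod 11 10 (Var x)) <= env 11.
Proof. by rewrite eval_rest (global11 g); apply: leq_trans (leq_mod _ _) (ltnW xN). Qed.

Lemma eval_choice : eval w env (choice_expr x) = choice_of m b V1 (env x).
Proof. by rewrite eval_Div // ?(global8 g) // eval_rest. Qed.

Lemma eval_total : eval w env (total_expr x) = total_of m b V1 (env x).
Proof. by rewrite eval_Mod // ?(global8 g) // eval_rest. Qed.

Let choice_closed : closed (choice_expr x). Proof. exact: closed_Div. Qed.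

Let choice_le : eval w env (choice_expr x) <= env 11.
Proof.
by rewrite eval_choice; apply: leq_trans (leq_div _ _) _; rewrite -eval_rest.
Qed.

Lemma eval_voter : eval w env (voter_expr x) = (pair_of m b V1 (env x)).1.
Proof. by rewrite eval_Div // ?(global7 g) // eval_choice. Qed.

Lemma eval_rank : eval w env (rank_expr x) = (pair_of m b V1 (env x)).2.
Proof. by rewrite eval_Mod // ?(global7 g) // eval_choice. Qed.

Lemma closed_node : [/\ closed (issue_expr x), closed (voter_expr x), closed (rank_expr x) &
  closed (total_expr x)].
Proof. by split; [exact: closed_Mod|exact: closed_Div|exact: closed_Mod|exact: closed_Mod]. Qed.

End Node.

Lemma eval_gain env j i e x y : globals env -> closed j -> closed i -> closed e ->
  eval w env (gain_expr j i e x y) =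
  gain_ok (points w) (eval w env j) (eval w env i, eval w env e) (eval w env x) (eval w env y).
Proof.
move=> g cj ci ce; have f z a : reserved z -> closed a -> fresh z a by exact: closed_fresh.
have ED a c : eval w env (Add a c) = eval w env a + eval w env c by [].
have E1 : eval w env (Sub e (Const 1)) = (eval w env e).-1 by rewrite -subn1.
have ce1 : closed (Sub e (Const 1)) by apply/andP.
by rewrite eval_Le !ED !eval_points ?E1 //= !f.
Qed.

Lemma eval_forbidden env x y : globals env -> ~~ reserved x -> ~~ reserved y ->
  env x < nodes m n b V1 -> env y < nodes m n b V1 ->
  eval w env (forbidden_expr x y) =
  forbidden m n b V1 (points w) (enough w) (env x) (env y).
Proof.
move=> g rx ry xN yN.
have [ci cv cr ct] := closed_node rx; have [ci' cv' cr' ct'] := closed_node ry.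
have ED a c : eval w env (Add a c) = eval w env a + eval w env c by [].
have Ex := (eval_slot g rx xN, eval_unit g rx xN, eval_issue g rx xN, eval_choice g rx xN,
  eval_total g rx xN, eval_voter g rx xN, eval_rank g rx xN).
have Ey := (eval_slot g ry yN, eval_unit g ry yN, eval_issue g ry yN, eval_choice g ry yN,
  eval_total g ry yN, eval_voter g ry yN, eval_rank g ry yN).
rewrite /forbidden; apply: eval_Or.
  apply: eval_And; first by rewrite eval_Eq Ex.
  apply: eval_not; apply: eval_And; first by rewrite eval_Eq Ex.
  rewrite eval_gain // !Ex eval_base ?Ex //=; last by rewrite !closed_fresh.
apply: eval_Or.
  apply: eval_And; first by rewrite eval_Eq ED Ex /= addn1 (global6 g).
  apply: eval_not; rewrite eval_enough ?Ex //; first exact: closed_fresh.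
  by rewrite ltn_mod.
apply: eval_Or.
  apply: eval_And; first by rewrite eval_Eq Ex Ey.
  by apply: eval_not; rewrite eval_Eq.
apply: eval_Or.
  apply: eval_And; first by rewrite eval_Eq Ex Ey.
  by apply: eval_not; rewrite eval_Eq Ex Ey.
apply: eval_And; first by rewrite eval_Eq Ex Ey.
apply: eval_And; first by rewrite eval_Eq ED Ex Ey /= addn1.
apply: eval_not; apply: eval_And; last by rewrite eval_gain // !Ex !Ey.
apply: eval_Or; apply: eval_And.
- by rewrite eval_Eq Ex Ey.
- by rewrite eval_Eq ED Ex Ey /= addn1.
- by rewrite eval_Lt Ex Ey.
- by rewrite eval_Eq Ey.
Qed.

Lemma eval_lost env j : globals env -> ~~ reserved j ->
  eval w env (lost_expr j) =
  (b == 0) && ~~ enough w (score m (points w) (fun=> 0) (env j)).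
Proof.
move=> g rj; have cj : closed (Var j) by [].
have E : eval w env (base_expr (Var j)) = score m (points w) (fun=> 0) (env j).
  by rewrite eval_base //= !closed_fresh.
apply: eval_And; first by rewrite eval_Eq /= (global6 g).
apply: eval_not; rewrite eval_enough ?E //; last exact: score_points_lt.
have j27 : j != 27 by apply: contraNneq rj => ->.
by rewrite /fresh /= j27 !orbT.
Qed.

End Globals.

(* The program that writes the circuit *)
#[local] Opaque forbidden_expr lost_expr.

(** The encoding announces the number of gates before listing them, so the clauses are counted in
    advance. The count also locates the disjunction. *)
Definition count_expr : expr :=
  Add (Sum 20 11 (Sum 21 11 (forbidden_expr 20 21))) (Sum 22 2 (lost_expr 22)).

Definition params : sets :=
  [:: (1, Entry (Const 0)); (2, Entry (Const 1));
      (3, Add (Entry (Const 2)) (Const 1)); (4, Add (Var 3) (Const 1));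
      (5, Entry (Const 3)); (6, Div 5 2 (Var 5)); (7, Add (Var 6) (Const 1));
      (8, Add (Mul 1 (Var 3)) (Const 1)); (9, Mul 6 (Var 2));
      (10, Mul 8 (Mul 7 (Var 1))); (11, Mul 9 (Var 10)); (12, count_expr)].

Definition emit_circuit : stm :=
  Seq (Emit (Var 11)) (Seq (Emit (Var 9)) (Seq (Emit (Add (Var 12) (Const 2)))
  (Seq (For 20 11 (For 21 11 (If (forbidden_expr 20 21)
         (Seq (Emit (Const 1)) (Seq (Emit (Const 2)) (Seq (Emit (Var 20)) (Emit (Var 21))))))))
  (Seq (For 22 2 (If (lost_expr 22) (Seq (Emit (Const 1)) (Emit (Const 0)))))
  (Seq (Emit (Const 2)) (Seq (Emit (Var 12))
  (Seq (For 23 12 (Emit (Add (Var 11) (Var 23))))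
  (Seq (Emit (Const 0)) (Seq (Emit (Const 1)) (Emit (Add (Var 11) (Var 12)))))))))))).

Lemma out_Seq w env p q : out w env (Seq p q) = out w env p ++ out w env q.
Proof. by []. Qed.

Lemma out_If w env e p (b : bool) :
  eval w env e = b -> out w env (If e p) = if b then out w env p else [::].
Proof. by move=> /= ->; case: b. Qed.

Lemma out_For w env x y p :
  out w env (For x y p) = flatten [seq out w (upd env x v) p | v <- iota 0 (env y)].
Proof. by []. Qed.

Lemma flatten_map_flatten (T S : Type) (f : T -> seq S) (s : seq (seq T)) :
  flatten [seq f c | c <- flatten s] = flatten [seq flatten [seq f c | c <- t] | t <- s].
Proof. by elim: s => //= t s IH; rewrite map_cat flatten_cat IH. Qed.

Section Output.

Variable w : word.
Let m := nth 0 w 0.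
Let n := nth 0 w 1.
Let k1 := (nth 0 w 2).+1.
Let b := nth 0 w 3 %/ n.
Let V1 := (m * k1).+1.
Let cs := clauses m n b V1 (points w) (enough w).
Let N := nodes m n b V1.

Hypothesis m_gt0 : 0 < m.
Hypothesis n_gt0 : 0 < n.

Lemma eval_count env : globals w env -> eval w env count_expr = size cs.
Proof.
move=> g; rewrite /cs /clauses size_cat !size_flatten /shape -!map_comp !sumnE !big_map.
rewrite -[eval _ _ _]/(eval w env (Sum 20 11 (Sum 21 11 (forbidden_expr 20 21))) +
  eval w env (Sum 22 2 (lost_expr 22))) !eval_Sum (global11 g) (global2 g).
have E K F : \sum_(i <- iota 0 K) F i = \sum_(i < K) F i :> nat.
  by rewrite -(big_mkord xpredT) /index_iota subn0.
rewrite !E; congr (_ + _); apply: eq_bigr => u _; rewrite [RHS]/=.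
  rewrite size_flatten /shape -map_comp sumnE big_map E.
  rewrite eval_Sum.
  have -> : upd env 20 u 11 = N by exact: (global11 g).
  apply: eq_bigr => u' _.
  have g2 : globals w (upd (upd env 20 u) 21 u') by do 2 apply: globals_upd => //.
  rewrite (@eval_forbidden w m_gt0 n_gt0 _ 20 21 g2 isT isT (ltn_ord u) (ltn_ord u')).
  by rewrite /upd /=; case: ifP.
rewrite (eval_lost (globals_upd _ (isT : 12 <= 22) g)) //.
by rewrite /upd /=; case: ifP.
Qed.

Lemma out_emit_circuit env : globals w env -> env 9 = b * n -> env 12 = size cs ->
  out w env emit_circuit =
  [:: N; b * n; size (gates (clause_circuit N cs))] ++
    flatten [seq encode_gate g | g <- gates (clause_circuit N cs)].
Proof.
move=> g e9 e12.
have em e : out w env (Emit e) = [:: eval w env e] by [].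
have E11 : env 11 = N := global11 g.
have H1 : out w env (For 20 11 (For 21 11 (If (forbidden_expr 20 21)
         (Seq (Emit (Const 1)) (Seq (Emit (Const 2)) (Seq (Emit (Var 20)) (Emit (Var 21)))))))) ++
   out w env (For 22 2 (If (lost_expr 22) (Seq (Emit (Const 1)) (Emit (Const 0))))) =
   flatten [seq encode_gate (GAnd c) | c <- cs].
  rewrite /cs /clauses map_cat flatten_cat; congr (_ ++ _).
    rewrite flatten_map_flatten -map_comp out_For E11; congr flatten; apply/eq_in_map => u.
    rewrite mem_iota => /andP[_ uN].
    rewrite [RHS]/=. rewrite flatten_map_flatten -map_comp out_For.
    have -> : upd env 20 u 11 = N by exact: E11.
    congr flatten; apply/eq_in_map => u'; rewrite mem_iota => /andP[_ uN'].
    rewrite (@out_If _ _ _ _ (forbidden m n b V1 (points w) (enough w) u u')).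
      by rewrite [RHS]/=; case: ifP => _; rewrite ?out_Seq /= ?/upd /=.
    have g2 : globals w (upd (upd env 20 u) 21 u') by do 2 apply: globals_upd => //.
    by rewrite (@eval_forbidden w m_gt0 n_gt0 _ 20 21 g2 isT isT uN uN').
  rewrite flatten_map_flatten -map_comp out_For (global2 g); congr flatten; apply/eq_in_map => j _.
  rewrite (@out_If _ _ _ _ ((b == 0) && ~~ enough w (score m (points w) (fun=> 0) j))).
    by rewrite [RHS]/=; case: ifP.
  by rewrite (eval_lost (globals_upd _ (isT : 12 <= 22) g)).
rewrite /emit_circuit !out_Seq !em [X in _ ++ _ ++ _ ++ X]catA H1.
rewrite /clause_circuit [gates _]/= size_cat size_map map_cat flatten_cat -map_comp.
rewrite [eval _ _ (Var 11)]/= E11 [eval _ _ (Var 9)]/= e9 [eval _ _ (Add _ _)]/= e12.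
congr [:: _, _, _ & _ ++ _].
rewrite /= E11 e12 size_iota; congr [:: _, _ & _ ++ _].
rewrite (_ : [seq _ | v <- _] = [seq [:: v] | v <- iota N (size cs)]).
  by elim: iota => //= a s ->.
by rewrite -[in RHS](addn0 N) iotaDl -map_comp; apply: eq_map => v /=; rewrite /upd /= E11.
Qed.

Definition sets_spec Q env l env' := sets_le Q w env l /\ set_env w env l = env'.

Lemma sets_cons Q env x e l env' v :
  eval w env e = v -> v <= Q -> sets_spec Q (upd env x v) l env' ->
  sets_spec Q env ((x, e) :: l) env'.
Proof. by move=> <- vQ [H1 H2]; split. Qed.

Lemma params_spec Q :
  (forall v, v \in [:: m; n; k1; k1.+1; nth 0 w 3; b; b.+1; V1; b * n;
                       block m b V1; N; size cs] -> v <= Q) ->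
  exists env, [/\ sets_spec Q (size_env w) params env, globals w env,
                   env 9 = b * n & env 12 = size cs].
Proof.
(* The final environment is left open and is determined by the successive assignments. *)
move=> HQ; eexists; split.
- apply: (@sets_cons _ _ _ _ _ _ m) => //; first by apply: HQ; rewrite !inE eqxx ?orbT.
  apply: (@sets_cons _ _ _ _ _ _ n) => //; first by apply: HQ; rewrite !inE eqxx ?orbT.
  apply: (@sets_cons _ _ _ _ _ _ k1); [by rewrite /= addn1|by apply: HQ; rewrite !inE eqxx ?orbT|].
  apply: (@sets_cons _ _ _ _ _ _ k1.+1); [by rewrite /= addn1|by apply: HQ; rewrite !inE eqxx ?orbT|].
  apply: (@sets_cons _ _ _ _ _ _ (nth 0 w 3)) => //; first by apply: HQ; rewrite !inE eqxx ?orbT.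
  apply: (@sets_cons _ _ _ _ _ _ b); [by rewrite eval_Div|by apply: HQ; rewrite !inE eqxx ?orbT|].
  apply: (@sets_cons _ _ _ _ _ _ b.+1); [by rewrite /= addn1|by apply: HQ; rewrite !inE eqxx ?orbT|].
  apply: (@sets_cons _ _ _ _ _ _ V1); [|by apply: HQ; rewrite !inE eqxx ?orbT|].
    by rewrite -[LHS]/(eval w _ (Mul 1 (Var 3)) + 1) eval_Mul // addn1.
  apply: (@sets_cons _ _ _ _ _ _ (b * n)); [by rewrite eval_Mul|by apply: HQ; rewrite !inE eqxx ?orbT|].
  apply: (@sets_cons _ _ _ _ _ _ (block m b V1)); [|by apply: HQ; rewrite !inE eqxx ?orbT|].
    by rewrite !eval_Mul ?fresh_Mul // /upd /= /block [b.+1 * _]mulnC mulnC.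
  apply: (@sets_cons _ _ _ _ _ _ N); [by rewrite eval_Mul|by apply: HQ; rewrite !inE eqxx ?orbT|].
  apply: (@sets_cons _ _ _ _ _ _ (size cs)); last by split.
    by apply: eval_count; split.
  by apply: HQ; rewrite !inE eqxx ?orbT.
- by split.
- by [].
- by [].
Qed.

End Output.

(** * Correctness and running time of the reduction *)

Lemma computes_within_leq p w T T' w' :
  T <= T' -> computes_within p w T w' -> computes_within p w T' w'.
Proof.
move=> le [t [s [H1 [H2 H3] H4 H5]]]; exists t, s; split=> //.
by split; [exact: leq_trans le|exact: leq_trans le].
Qed.

Lemma computable_id : computable id.
Proof.
exists (compile [::] (Emit (Entry (Const 0)))) => x; eexists.
exact: (@compile_computes [:: x] 1 [::] (Emit (Entry (Const 0)))).
Qed.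

Lemma computable_poly A D : computable (fun x => A * x.+1 ^ D).
Proof.
pose e := iter D (Mul 1) (Const A); pose l := [:: (1, Add (Entry (Const 0)) (Const 1))].
exists (compile l (Emit e)) => x; eexists.
have <- : out [:: x] (set_env [:: x] (size_env [:: x]) l) (Emit e) = [:: A * x.+1 ^ D].
  set env := set_env _ _ _; have env1 : env 1 = x.+1 by rewrite /env /= /upd /= addn1.
  rewrite -[LHS]/[:: eval [:: x] env e]; congr cons; rewrite /e.
  elim: D @e => [|D IH] e; first by rewrite muln1.
  rewrite -[iter D.+1 _ _]/(Mul 1 (iter D (Mul 1) (Const A))) eval_Mul; last first.
    by case: D {IH e} => // D; exact: fresh_Mul.
  by rewrite IH env1 expnS mulnCA.
by apply: (@compile_computes [:: x] x.+1 l (Emit e)) => //=; rewrite addn1.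
Qed.

Lemma size_le_wsize w : size w <= wsize w.
Proof. by rewrite /wsize -sum1_size leq_sum. Qed.

Section Reduction.

Variable x : vbam_instance.

Let w := vbam_encode x.
Let m := nvoters x.
Let n := nissues x.
Let b := budget x %/ n.
Let V1 := (m * (level x).+1).+1.
Let cs := clauses m n b V1 (points w) (enough w).
Let N := nodes m n b V1.

Definition reduction : wcs_instance 2 3 :=
  @WcsInstance 2 3 (clause_circuit N cs) (b * n)
    (clause_circuit_wf (clauses_clauses_ok _ _ _ _ _ _))
    (clause_circuit_weft (clauses_clauses_ok _ _ _ _ _ _))
    (clause_circuit_depth (clauses_clauses_ok _ _ _ _ _ _)).

Lemma reduction_yes : vbam_yes x <-> wcs_yes reduction.
Proof.
rewrite vbam_yesP; apply: clause_circuit_correct.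
- exact: nvoters_gt0.
- exact: nissues_gt0.
- exact: (@points_mono w).
- exact: (score_points_lt w).
- exact: (@enough_up w).
Qed.

Lemma size_clauses : size cs <= N * N + n.
Proof.
rewrite /cs /clauses size_cat; apply: leq_add.
  rewrite size_flatten /shape -map_comp sumnE big_map -[X in _ <= X * _](size_iota 0 N).
  rewrite -sum1_size big_distrl /=; apply: leq_sum => u _.
  rewrite mul1n size_flatten /shape -map_comp sumnE big_map -[leqRHS](size_iota 0 N) -sum1_size.
  by apply: leq_sum => u' _ /=; case: ifP.
rewrite size_flatten /shape -map_comp sumnE big_map -[leqRHS](size_iota 0 n) -sum1_size.
by apply: leq_sum => u' _ /=; case: ifP.
Qed.

(** Put [q = (B + 1) * (L + 1)] with [L] the input length. A block has at most [q ^ 2] nodes, as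
    [m * (b + 1)] and the number of scores are at most [q]. With [b * n <= B] there are at most
    [q ^ 3] nodes, hence at most [q ^ 6 + n] clauses, which [q ^ 7] bounds. *)
Lemma params_le v :
  v \in [:: m; n; (level x).+1; (level x).+2; budget x; b; b.+1; V1; b * n;
            block m b V1; N; size cs] ->
  v <= ((budget x).+1 * (size w).+1) ^ 7.
Proof.
set B := budget x; set L := size w; set q := B.+1 * L.+1.
have m0 : 0 < m := nvoters_gt0 x; have n0 : 0 < n := nissues_gt0 x.
have LE : L = 6 + (m * n).*2 + m * n * (level x).+2 + n by rewrite /L size_vbam_encode.
pose K := level x; rewrite -/K in LE.
have mn : m <= m * n /\ n <= m * n by rewrite leq_pmulr // leq_pmull.
have mL : m <= L by lia.
have nL : n <= L by lia.
have kL : K.+2 <= L.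
  have : K.+2 <= m * n * K.+2 by rewrite leq_pmull // muln_gt0 m0.
  by lia.
have VL : m * K.+1 < L.
  have : m * K.+1 <= m * n * K.+2 by apply: leq_mul; lia.
  by lia.
have bB : b <= B by exact: leq_div.
have bn : b * n <= B by exact: leq_trunc_div.
have Lq u : u <= L.+1 -> u <= q by move=> uL; apply: leq_trans uL (leq_pmull _ _).
have Bq u : u <= B.+1 -> u <= q by move=> uB; apply: leq_trans uB (leq_pmulr _ _).
have q7 : 6 < q by apply: Lq; lia.
have q1 : q <= q ^ 7 by rewrite -[leqLHS]expn1 leq_pexp2l //; lia.
have blk : block m b (m * K.+1).+1 <= q ^ 2.
  rewrite /block [q ^ 2]expnS expn1; apply: leq_mul; last by apply: Lq; lia.
  by rewrite /q [leqRHS]mulnC; apply: leq_mul; lia.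
have ND : nodes m n b (m * K.+1).+1 <= q ^ 3.
  by rewrite /nodes [q ^ 3]expnS; apply: leq_mul => //; apply: Bq; lia.
have CS : size cs <= q ^ 7.
  apply: leq_trans size_clauses _; rewrite /N /V1 -/K.
  have H : nodes m n b (m * K.+1).+1 * nodes m n b (m * K.+1).+1 <= q ^ 6.
    by rewrite (expnD q 3 3); apply: leq_mul.
  have nq : n <= q ^ 6.
    apply: (@leq_trans (q ^ 1)); first by rewrite expn1; apply: Lq; lia.
    by rewrite leq_pexp2l //; lia.
  apply: leq_trans (leq_add H nq) _; rewrite addnn -mul2n expnS leq_mul2r.
  by rewrite (leq_trans _ q7) ?orbT.
have pq d : d <= 7 -> q ^ d <= q ^ 7 by move=> d7; rewrite leq_pexp2l //; lia.
have L7 u : u <= L.+1 -> u <= q ^ 7 by move=> /Lq /leq_trans; apply.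
have B7 u : u <= B.+1 -> u <= q ^ 7 by move=> /Bq /leq_trans; apply.
rewrite /N /V1 -/K !inE => H.
case/orP: H => [/eqP ->|H]; first by apply: L7; exact: leqW.
case/orP: H => [/eqP ->|H]; first by apply: L7; exact: leqW.
case/orP: H => [/eqP ->|H]; first by apply: L7; apply: leqW; exact: ltnW.
case/orP: H => [/eqP ->|H]; first by apply: L7; exact: leqW.
case/orP: H => [/eqP ->|H]; first exact: B7.
case/orP: H => [/eqP ->|H]; first by apply: B7; exact: leqW.
case/orP: H => [/eqP ->|H]; first exact: B7.
case/orP: H => [/eqP ->|H]; first by apply: L7; exact: leqW.
case/orP: H => [/eqP ->|H]; first by apply: B7; exact: leqW.
case/orP: H => [/eqP ->|H]; first exact: leq_trans blk (pq 2 _).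
case/orP: H => [/eqP ->|H]; first exact: leq_trans ND (pq 3 _).
by rewrite (eqP H).
Qed.

Lemma reduction_param : b * n <= budget x.
Proof. exact: leq_trunc_div. Qed.

Lemma reduction_computed :
  computes_within (compile params emit_circuit) w
    (let Q := ((budget x).+1 * (size w).+1) ^ 7 in
     3 + sets_cost Q params (stm_cost Q emit_circuit * 7 + 4))
    (wcs_encode reduction).
Proof.
have m0 : 0 < nth 0 w 0 := nvoters_gt0 x; have n0 : 0 < nth 0 w 1 := nissues_gt0 x.
have [env [[le envE] g e9 e12]] := params_spec m0 n0 params_le.
rewrite -[wcs_encode _](out_emit_circuit m0 n0 g e9 e12) -envE.
apply: compile_computes le.
set L := size w; rewrite -[leqLHS]expn1.
apply: (@leq_trans (((budget x).+1 * L.+1) ^ 1)); last by rewrite leq_pexp2l // muln_gt0.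
by rewrite !expn1; nia.
Qed.

End Reduction.

Theorem theorem5p4 : W 2 VB_AM_Probabilistic_Lobbying.
Proof.
exists 3; have [A [D H]] := compile_poly params emit_circuit.
(* The time is at most [A * (Q + 1) ^ D] with [Q = q ^ 7], and [Q + 1 <= q ^ 8] as [q > 1]. Since
   [q] is a product of a budget factor and a length factor, its power splits as required. The new
   parameter [b * n] never exceeds the budget, so [id] bounds it. *)
exists reduction, (compile params emit_circuit), (fun B => A * B.+1 ^ (8 * D)), id, (8 * D).
split; [exact: computable_poly|exact: computable_id|].
move=> x; split; [exact: reduction_yes|exact: reduction_param|].
apply: computes_within_leq (reduction_computed x).
set L := size _; set L' := wsize _; apply: leq_trans (H _) _.
have LL : L <= L' := size_le_wsize _.
set q := (budget x).+1 * L.+1.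
have q2 : 1 < q by rewrite /q /L size_vbam_encode; nia.
rewrite -mulnA leq_mul2l -expnMn expnM; apply/orP; right.
have le : (q ^ 7).+1 <= ((budget x).+1 * L'.+1) ^ 8.
  apply: (@leq_trans (q ^ 8)); first by rewrite (expnS q 7); have := expn_gt0 q 7; nia.
  by rewrite leq_exp2r // leq_mul2l ltnS LL.
by case: D {H} => // D; rewrite leq_exp2r.
Qed.
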